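(* Suppose $P$ is weakly communicating. Let $\widehat\pi$ be a bias-optimal policy of the empirical average-reward MDP $(\widehat P,r)$, let $\widehat h^\star$ be the optimal bias of $(\widehat P,r)$, and let $\widehat\gamma^\star$ be the (random) smallest discount factor $\bar\gamma\in[0,1)$ such that for every $\gamma\in[\bar\gamma,1)$ there exists $c\in\mathbb R$ (possibly depending on $\gamma$) with $$\big\|\widehat V^\star_\gamma-\widehat h^\star-c\mathbf 1\big\|_\infty\le \tfrac1n .$$ There is an absolute constant $C>0$ such that for every $\delta\in(0,1)$, with probability at least $1-\delta$ the following holds: if $\widehat P$ is weakly communicating, then $$\rho^\star-\rho^{\widehat\pi}\le \sqrt{\frac{C\log^3\!\big(\frac{SAn}{\delta(1-\widehat\gamma^\star)}\big)}{n}\Big(\|h^\star\|_{\mathrm{sp}}+\|\widehat h^\star\|_{\mathrm{sp}}+1\Big)}\;\mathbf 1 .$$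
   Context: $\mathcal S$ is a finite state set with $S$ elements, $\mathcal A$ a finite action set with $A$ elements. A transition kernel $P$ gives distributions $P(\cdot\mid s,a)$ on $\mathcal S$; the reward $r:\mathcal S\times\mathcal A\to[0,1]$ is deterministic and known. Policies are stationary Markov, possibly randomized; $P_\pi(s,s')=\sum_a\pi(a|s)P(s'|s,a)$, $r_\pi(s)=\sum_a\pi(a|s)r(s,a)$. Empirical kernel: for each $(s,a)$, $n$ i.i.d. samples $S^1_{s,a},\dots,S^n_{s,a}\sim P(\cdot|s,a)$ are drawn (independently across pairs) and $\widehat P(s'|s,a)=\frac1n\sum_{i=1}^n\mathbb 1\{S^i_{s,a}=s'\}$. For $\gamma\in(0,1)$, $V^\pi_\gamma=(I-\gamma P_\pi)^{-1}r_\pi$ and $V^\star_\gamma=\max_\pi V^\pi_\gamma$ (elementwise). $P^\infty_\pi$ is the Cesàro limit of $P_\pi^t$; the gain is $\rho^\pi=P^\infty_\pi r_\pi$ and the bias is $h^\pi=\mathrm{C\text{-}lim}_{T\to\infty}\sum_{t=0}^{T-1}(P_\pi^t r_\pi-\rho^\pi)$ (Cesàro limit). A deterministic policy $\pi^\star$ is Blackwell-optimal if for some $\bar\gamma<1$, $V^{\pi^\star}_\gamma\ge V^\pi_\gamma$ for all policies $\pi$ and all $\gamma\in[\bar\gamma,1)$; $\rho^\star=\rho^{\pi^\star}$ is the optimal gain and $h^\star=h^{\pi^\star}$ the optimal bias. A policy is bias-optimal if its gain equals $\rho^\star$ and its bias equals $h^\star$. Quantities computed with $\widehat P$ in place of $P$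 carry hats ($\widehat V^\star_\gamma$, $\widehat h^\star$, etc.). $\|x\|_{\mathrm{sp}}=\max_s x(s)-\min_s x(s)$; $\mathbf 1$ is the all-ones vector; vector inequalities are elementwise. An MDP is weakly communicating if $\mathcal S$ splits into a set of states transient under every stationary policy and a set in which every state is reachable from every other under some policy. *)

(* Defs.v *)
From HB Require Import structures.
From mathcomp Require Import all_boot all_order all_algebra.
From mathcomp Require Import all_classical all_reals all_analysis.
Set Implicit Arguments. Unset Strict Implicit. Unset Printing Implicit Defensive.
Import Order.TTheory GRing.Theory Num.Theory.
Import numFieldNormedType.Exports.
Local Open Scope ring_scope.
Local Open Scope classical_set_scope.

Section MDP.
Variables (R : realType) (nS nA : nat).

Definition mkernel := 'I_nS -> 'I_nA -> 'I_nS -> R.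
Definition is_kernel (P : mkernel) : Prop :=
  (forall s a s', 0 <= P s a s') /\ (forall s a, \sum_(s' < nS) P s a s' = 1).

Definition policy := 'I_nS -> 'I_nA -> R.
Definition is_policy (pi : policy) : Prop :=
  (forall s a, 0 <= pi s a) /\ (forall s, \sum_(a < nA) pi s a = 1).

Definition det_policy := 'I_nS -> 'I_nA.
Definition of_det (d : det_policy) : policy := fun s a => ((d s == a) : nat)%:R.

Definition Ppi (P : mkernel) (pi : policy) : 'M[R]_nS :=
  \matrix_(s, s') \sum_(a < nA) pi s a * P s a s'.
Definition rpi (r : 'I_nS -> 'I_nA -> R) (pi : policy) : 'cV[R]_nS :=
  \col_s \sum_(a < nA) pi s a * r s a.

Definition Vpi (P : mkernel) r (pi : policy) (g : R) : 'cV[R]_nS :=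
  invmx (1%:M - g *: Ppi P pi) *m rpi r pi.
(* V^*_gamma = elementwise max over all policies (the max is attained, so it is the sup) *)
Definition Vstar (P : mkernel) r (g : R) : 'cV[R]_nS :=
  \col_s sup [set (Vpi P r pi g) s 0 | pi in [set pi | is_policy pi]].

Definition cesaro (u : nat -> R) : R :=
  limn (fun T : nat => (T.+1%:R)^-1 * \sum_(k < T.+1) u k).

Definition Pinf (P : mkernel) (pi : policy) : 'M[R]_nS :=
  \matrix_(s, s') cesaro (fun t => (Ppi P pi ^+ t) s s').
Definition gain (P : mkernel) r (pi : policy) : 'cV[R]_nS := Pinf P pi *m rpi r pi.
Definition bias (P : mkernel) r (pi : policy) : 'cV[R]_nS :=
  \col_s cesaro (fun T => \sum_(t < T)
     (((Ppi P pi ^+ t) *m rpi r pi) s 0 - gain P r pi s 0)).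

Definition blackwell_optimal (P : mkernel) r (d : det_policy) : Prop :=
  exists gbar : R, gbar < 1 /\
    forall pi : policy, is_policy pi ->
    forall g : R, gbar <= g -> 0 < g -> g < 1 ->
      forall s, Vpi P r pi g s 0 <= Vpi P r (of_det d) g s 0.

(* optimal gain / bias are those of a Blackwell-optimal policy dstar *)
Definition bias_optimal (P : mkernel) r (dstar : det_policy) (pi : policy) : Prop :=
  gain P r pi = gain P r (of_det dstar) /\ bias P r pi = bias P r (of_det dstar).

(* state s is transient for the chain M: finite expected number of visits,
   i.e. the partial sums of sum_t M^t(s,s) are bounded *)
Definition transient (M : 'M[R]_nS) (s : 'I_nS) : Prop :=
  exists B : R, forall T : nat, \sum_(t < T) (M ^+ t) s s <= B.

Definition weakly_communicating (P : mkernel) : Prop :=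
  exists Tr Cl : {set 'I_nS},
    Tr :&: Cl = finset.set0 /\ Tr :|: Cl = finset.setT /\
    (forall s, s \in Tr -> forall pi, is_policy pi -> transient (Ppi P pi) s) /\
    (forall s s', s \in Cl -> s' \in Cl ->
       exists pi, is_policy pi /\ exists t : nat, 0 < (Ppi P pi ^+ t) s s').

Definition spnorm (x : 'cV[R]_nS) : R :=
  sup [set x s 0 | s in [set: 'I_nS]] - inf [set x s 0 | s in [set: 'I_nS]].
Definition supnorm (x : 'cV[R]_nS) : R := \big[Order.max/0]_(s < nS) `|x s 0|.

(* msample space: omega (s,a,i) = S^i_{s,a} *)
Definition msample (n : nat) := {ffun 'I_nS * 'I_nA * 'I_n -> 'I_nS}.
Definition sample_prob (P : mkernel) n (w : msample n) : R :=
  \prod_(k : 'I_nS * 'I_nA * 'I_n) P k.1.1 k.1.2 (w k).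
Definition Prob (P : mkernel) n (E : msample n -> Prop) : R :=
  \sum_(w : msample n) (if `[< E w >] then sample_prob P w else 0).

Definition Phat n (w : msample n) : mkernel :=
  fun s a s' => (n%:R)^-1 * (#|[set i : 'I_n | w (s, a, i) == s']|)%:R.

Definition gamma_hat_star (Ph : mkernel) r (hh : 'cV[R]_nS) (n : nat) : R :=
  inf [set gbar : R | 0 <= gbar /\ gbar < 1 /\
        forall g : R, gbar <= g -> g < 1 ->
          exists c : R, supnorm (Vstar Ph r g - hh - c *: const_mx 1) <= (n%:R)^-1].
End MDP.
Arguments Phat R {nS nA n}.
Arguments of_det {R nS nA}.

(* Main.v *)
Require Import Defs.
From HB Require Import structures.
From mathcomp Require Import all_boot all_order all_algebra.
From mathcomp Require Import all_classical all_reals all_analysis.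
From mathcomp Require Import ring lra.
Set Implicit Arguments.
Unset Strict Implicit.
Unset Printing Implicit Defensive.
Import Order.TTheory GRing.Theory Num.Theory.
Import numFieldNormedType.Exports.
Local Open Scope ring_scope.

(** Write [rho* - rho^pihat] as (rho* - gain of pistar under Phat) + (that gain -
    optimal empirical gain) + (optimal empirical gain - rho^pihat); the middle
    difference is nonpositive.  The outer two compare the gains of one policy
    under two kernels Q, Q' through the Poisson equation of Q': with mu a
    stationary law of Q, the gap is the mu-average of (Q' - Q) h.  A Bernstein
    bound for (Q' - Q) h involves the variance of h, and the mu-average of that
    variance is again controlled by the Poisson equation, because
    h^2 - (Q' h)^2 = (r - rho)(h + Q' h) is at most 2 |h|_sp; this replaces
    |h|_sp^2 by |h|_sp.

    For the first difference h = h* is deterministic.  For the last one h is the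
    empirical bias, which depends on the samples at (s, a); it is within 1/n, up
    to a constant, of Vstar at a discount gamma > ghat, and Vstar is approximated
    by value iteration in the MDP whose Q-value at (s, a) is pinned to a grid
    point, which is independent of the samples at (s, a).  A union bound over the
    grid and over gamma = 1 - 2^-(k+1) yields the logarithm of 1/(1 - ghat). *)

(** The stationary law belongs to the kernel whose gain is evaluated, so the variance must be taken
    under that kernel: under [P] for the plug-in policy, under the random [Phat] for [pistar]. Hence
    two exponential tests, one compensated by the true variance, one by squares at the sampled
    points. Centring at the mean of the other kernel adds a term proportional to the deviation
    itself; it is absorbed while the rate [sqrt (ell (sp + 7) / n)] is at most 1/64, and beyond that
    the claimed bound exceeds 1.

    Row [(s, a)] enters the optimality equation only through one real number, its Q-value, so a
    one-dimensional grid is enough. The pin enters value iteration through a maximum, so its error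
    is not multiplied by [1 / (1 - g)]: mesh [1 / n] will do, and about [n / (1 - g)] grid points
    cost only a logarithm.

    Weak communication acts through constancy of the optimal gain: the Poisson equation then has a
    scalar [rho], and [ghat < 1]. *)

(** * Stochastic matrices, Cesaro limits and the Poisson equation *)

Definition stochastic (R : realType) n (M : 'M[R]_n) : Prop :=
  (forall i j, 0 <= M i j) /\ (forall i, \sum_j M i j = 1).

Lemma stochastic_Ppi (R : realType) nS nA (P : mkernel R nS nA) pi :
  is_kernel P -> is_policy pi -> stochastic (Ppi P pi).
Proof.
move=> [P0 P1] [pi0 pi1]; split=> [i j|i].
  by rewrite mxE; apply: sumr_ge0 => a _; rewrite mulr_ge0.
under eq_bigr do rewrite mxE.
rewrite exchange_big /= -[RHS](pi1 i); apply: eq_bigr => a _.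
by rewrite -mulr_sumr P1 mulr1.
Qed.

Lemma stochastic_exp (R : realType) n (M : 'M[R]_n) t :
  stochastic M -> stochastic (M ^+ t).
Proof.
move=> [M0 M1]; elim: t => [|t [IH0 IH1]].
  rewrite expr0; split=> [i j|i]; first by rewrite mxE ler0n.
  rewrite (bigD1 i) //= big1 ?addr0; first by rewrite mxE eqxx.
  by move=> j ji; rewrite mxE eq_sym (negbTE ji).
rewrite exprS; split=> [i j|i].
  by rewrite mxE; apply: sumr_ge0 => k _; rewrite mulr_ge0.
under eq_bigr do rewrite mxE.
rewrite exchange_big /= -[RHS](M1 i); apply: eq_bigr => k _.
by rewrite -mulr_sumr IH1 mulr1.
Qed.

Lemma stochastic_mono (R : realType) n p (M : 'M[R]_n) (u v : 'M[R]_(n, p)) j :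
  stochastic M -> (forall s, u s j <= v s j) ->
  forall s, (M *m u) s j <= (M *m v) s j.
Proof.
move=> [M0 _] uv s; rewrite !mxE; apply: ler_sum => k _.
by rewrite ler_wpM2l.
Qed.

Lemma stochastic_const (R : realType) n p (M : 'M[R]_n) (c : R) :
  stochastic M -> M *m (const_mx c : 'M[R]_(n, p)) = const_mx c.
Proof.
move=> [_ M1]; apply/matrixP => i j; rewrite !mxE.
by under eq_bigr do rewrite mxE; rewrite -mulr_suml M1 mul1r.
Qed.

Lemma stochastic_norm (R : realType) n p (M : 'M[R]_n) (v : 'M[R]_(n, p)) c j :
  stochastic M -> (forall s, `|v s j| <= c) -> forall s, `|(M *m v) s j| <= c.
Proof.
move=> Mst vc s; have Mc : forall d, (M *m const_mx d : 'M[R]_(n, p)) s j = d.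
  by move=> d; rewrite stochastic_const // mxE.
rewrite ler_norml -{1}(Mc (- c)) -{2}(Mc c).
by apply/andP; split; apply: stochastic_mono => // k; rewrite mxE;
  have := vc k; rewrite ler_norml => /andP[].
Qed.

Lemma mx_bounded (R : realType) n p (v : 'M[R]_(n, p)) :
  exists c, 0 <= c /\ forall i j, `|v i j| <= c.
Proof.
exists (\sum_i \sum_j `|v i j|); split.
  by apply: sumr_ge0 => i _; apply: sumr_ge0.
move=> i j; rewrite (bigD1 i) //= (bigD1 j) //= -addrA lerDl.
rewrite addr_ge0 //; first exact: sumr_ge0.
by apply: sumr_ge0 => k _; apply: sumr_ge0.
Qed.

(* The powers of M are bounded, whereas M^t z = z - t y. *)
Lemma stochastic_ker_im (R : realType) n p (M : 'M[R]_n) (y z : 'M[R]_(n, p)) :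
  stochastic M -> M *m y = y -> y = z - M *m z -> y = 0.
Proof.
move=> Mst My yz.
have Mt t : M ^+ t *m z = z - t%:R *: y.
  elim: t => [|t IH]; first by rewrite expr0 mul1mx scale0r subr0.
  rewrite exprS -mulmxA IH mulmxBr -scalemxAr My -natr1 scalerDl scale1r.
  have -> : M *m z = z - y by rewrite yz opprB addrC subrK.
  by rewrite -addrA -opprD [y + _]addrC.
have [c [c0 zc]] := mx_bounded z.
apply/matrixP => i j; rewrite [RHS]mxE; apply/eqP/negPn/negP => y0.
have ypos : 0 < `|y i j| by rewrite normr_gt0.
have := stochastic_norm (stochastic_exp (Num.truncn (2 * c / `|y i j|)).+1 Mst)
  (zc^~ j) i.
rewrite Mt; set t := _.+1.
have tc : 2 * c < t%:R * `|y i j|.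
  rewrite -ltr_pdivrMr //; exact: truncnS_gt.
rewrite !mxE => h; have : t%:R * `|y i j| <= 2 * c.
  rewrite -[t%:R]normr_nat -normrM.
  have -> : t%:R * y i j = z i j - (z i j - t%:R * y i j) by ring.
  by rewrite (le_trans (ler_normB _ _)) // mulrDl mul1r lerD.
by move=> /le_lt_trans/(_ tc); rewrite ltxx.
Qed.

(** By [stochastic_ker_im] the kernel and the image of [1 - M] meet only in 0, so by rank they span
    the space: [Q] projects onto the kernel along the image, and [D] is the deviation matrix. That
    [D] itself lies in the image is what the Cesaro limit defining the bias requires. *)
Lemma stochastic_decomp (R : realType) n (M : 'M[R]_n) : stochastic M ->
  exists Q D G : 'M[R]_n,
    [/\ M *m Q = Q, 1%:M = Q + (D - M *m D) & D = G - M *m G].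
Proof.
move=> Mst; set A := (1%:M - M)^T; set K := kermx A.
have cap0 : (K :&: A)%MS = 0.
  set w := (K :&: A)%MS.
  have wA : w *m A = 0 by apply/sub_kermxP; exact: capmxSl.
  have /submxP[x wx] : (w <= A)%MS by exact: capmxSr.
  apply: trmx_inj; rewrite trmx0.
  apply: (@stochastic_ker_im _ _ _ M _ x^T) => //.
    apply/eqP; rewrite eq_sym -subr_eq0; apply/eqP.
    by rewrite -{1}[w^T]mul1mx -mulmxBl -[1%:M - M]trmxK -trmx_mul wA trmx0.
  by rewrite wx trmx_mul trmxK mulmxBl mul1mx.
have full : row_full (K + A)%MS.
  rewrite /row_full; have := mxrank_sum_cap K A.
  by rewrite cap0 mxrank0 addn0 mxrank_ker => ->; rewrite subnK // rank_leq_row.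
have /sub_addsmxP[[u1 u2] /= e] : (1%:M <= K + A)%MS by exact: submx_full.
pose D0 := u2^T.
have e' : 1%:M = (u1 *m K)^T + (D0 - M *m D0).
  by rewrite -[LHS]trmx1 e linearD /= !trmx_mul trmxK mulmxBl mul1mx.
have MQ : M *m (u1 *m K)^T = (u1 *m K)^T.
  apply/eqP; rewrite eq_sym -subr_eq0; apply/eqP.
  rewrite -{1}[(u1 *m K)^T]mul1mx -mulmxBl -[1%:M - M]trmxK -trmx_mul.
  by rewrite -mulmxA mulmx_ker mulmx0 trmx0.
(* [D0] is determined only up to the kernel; passing to [(1 - M) D0 D0 = D0 - Q D0] removes that
   component. *)
exists (u1 *m K)^T, ((D0 - M *m D0) *m D0), (D0 *m D0); split=> //.
- have -> : (D0 - M *m D0) *m D0 = D0 - (u1 *m K)^T *m D0.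
    apply: (addrI ((u1 *m K)^T *m D0)).
    by rewrite -mulmxDl -e' mul1mx addrC subrK.
  rewrite [LHS]e'; congr (_ + _).
  by rewrite mulmxBr (mulmxA M) MQ opprB addrA subrK.
- by rewrite mulmxBl mulmxA.
Qed.

Lemma cesaro_telescope (R : realType) (u e : nat -> R) l c :
  (forall t, u t = l + (e t - e t.+1)) -> (forall t, `|e t| <= c) ->
  ((fun T : nat => (T.+1%:R)^-1 * \sum_(k < T.+1) u k) @ \oo --> l)%classic.
Proof.
move=> ue ec.
have sumE T : \sum_(k < T) u k = l *+ T + (e 0%N - e T).
  elim: T => [|T IH]; first by rewrite big_ord0 mulr0n subrr addr0.
  by rewrite big_ord_recr /= IH ue mulrSr; ring.
apply/cvgrPdist_le => eps eps0.
near=> T.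
rewrite sumE mulrDr -[l *+ _]mulr_natl mulKf ?pnatr_eq0 // opprD addrA subrr.
rewrite sub0r normrN normrM normfV normr_nat.
rewrite ler_pdivrMl ?ltr0Sn // (@le_trans _ _ (c + c)) //.
  by rewrite (le_trans (ler_normB _ _)) // lerD.
rewrite -ler_pdivrMr //.
near: T; exists (Num.truncn ((c + c) / eps)) => // T /= hT.
by apply/ltW/(lt_le_trans (truncnS_gt _)); rewrite ler_nat ltnS.
Unshelve. all: by end_near. Qed.

Lemma cesaro_eq (R : realType) (u e : nat -> R) l c :
  (forall t, u t = l + (e t - e t.+1)) -> (forall t, `|e t| <= c) ->
  Defs.cesaro u = l.
Proof. by move=> ue ec; apply: cvg_lim => //; exact: cesaro_telescope ue ec. Qed.

Lemma sum_kernel_decomp (R : realType) n (M Q D : 'M[R]_n) t :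
  M *m Q = Q -> 1%:M = Q + (D - M *m D) ->
  M ^+ t = Q + (M ^+ t *m D - M ^+ t.+1 *m D).
Proof.
move=> MQ e.
have MtQ : M ^+ t *m Q = Q.
  elim: t => [|t IH]; first by rewrite expr0 mul1mx.
  by rewrite exprSr -mulmxA MQ.
by rewrite -{1}[M ^+ t]mulmx1 e mulmxDr MtQ mulmxBr mulmxA exprSr.
Qed.

Lemma stochastic_mulmx_bounded (R : realType) n p (M : 'M[R]_n) (v : 'M[R]_(n, p)) :
  stochastic M -> exists c, forall t i j, `|(M ^+ t *m v) i j| <= c.
Proof.
move=> Mst; have [c [_ vc]] := mx_bounded v.
exists c => t i j; apply: stochastic_norm => //; exact: stochastic_exp.
Qed.

(** The partial sums defining the bias are [D *m rpi - M ^+ T *m D *m rpi], and [D = G - M *m G]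
    makes the last term telescope, so it averages to 0. *)
Lemma bias_decomp (R : realType) nS nA (P : mkernel R nS nA) pi :
  is_kernel P -> is_policy pi -> exists D G : 'M[R]_nS,
  [/\ Ppi P pi *m Pinf P pi = Pinf P pi,
      1%:M = Pinf P pi + (D - Ppi P pi *m D), D = G - Ppi P pi *m G &
      forall r, bias P r pi = D *m rpi r pi].
Proof.
move=> Pk pk; have Mst := stochastic_Ppi Pk pk.
set M := Ppi P pi in Mst *.
have [Q [D [G [MQ e DG]]]] := stochastic_decomp Mst.
have QE : Pinf P pi = Q.
  have [c Dc] := stochastic_mulmx_bounded D Mst.
  apply/matrixP => i j; rewrite mxE.
  apply: (@cesaro_eq _ _ (fun t => (M ^+ t *m D) i j) _ c) => // t.
  by rewrite {1}(sum_kernel_decomp t MQ e) !mxE.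
exists D, G; rewrite QE; split=> // r.
have [c Gc] := stochastic_mulmx_bounded (G *m rpi r pi) Mst.
have biasT T : \sum_(t < T) (((M ^+ t) *m rpi r pi) - Q *m rpi r pi)
    = D *m rpi r pi - M ^+ T *m D *m rpi r pi.
  elim: T => [|T IH]; first by rewrite big_ord0 expr0 mul1mx subrr.
  rewrite big_ord_recr /= IH {2}(sum_kernel_decomp T MQ e).
  by rewrite -[in X in _ + X = _]mulmxBl [Q + _]addrC addrK mulmxBl addrA subrK.
have MD T : M ^+ T *m D *m rpi r pi
    = M ^+ T *m (G *m rpi r pi) - M ^+ T.+1 *m (G *m rpi r pi).
  by rewrite {1}DG mulmxBr mulmxBl exprSr -!mulmxA.
apply/colP => s; rewrite mxE.
apply: (@cesaro_eq _ _ (fun T => - (M ^+ T *m (G *m rpi r pi)) s 0) _ c).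
  move=> T; have := congr1 (fun v : 'cV[R]_nS => v s 0) (biasT T).
  have mxB (A B : 'cV[R]_nS) : (A - B) s 0 = A s 0 - B s 0 by rewrite !mxE.
  rewrite summxE; under eq_bigr do rewrite mxB.
  rewrite /gain QE MD !mxB => ->.
  by rewrite -opprD.
by move=> T; rewrite normrN.
Qed.

Lemma opp_mxE (R : realType) n p (A : 'M[R]_(n, p)) i j : (- A) i j = - A i j.
Proof. by rewrite mxE. Qed.

Lemma sub_mxE (R : realType) n p (A B : 'M[R]_(n, p)) i j :
  (A - B) i j = A i j - B i j.
Proof. by rewrite !mxE. Qed.

Lemma add_mxE (R : realType) n p (A B : 'M[R]_(n, p)) i j :
  (A + B) i j = A i j + B i j.
Proof. by rewrite mxE. Qed.

(** This makes the rows of [Pinf] stationary laws. Since [Q = 1 - (1 - M) D], one has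
    [Q (1 - M) = (1 - M) (1 - D (1 - M))]: a matrix fixed by [M] and in the image of [1 - M], hence
    0. *)
Lemma Pinf_mulr (R : realType) nS nA (P : mkernel R nS nA) pi :
  is_kernel P -> is_policy pi -> Pinf P pi *m Ppi P pi = Pinf P pi.
Proof.
move=> Pk pk; have Mst := stochastic_Ppi Pk pk.
have [D [G [MQ e _ _]]] := bias_decomp Pk pk.
set M := Ppi P pi in Mst MQ e *; set Q := Pinf P pi in MQ e *.
apply/eqP; rewrite eq_sym -subr_eq0; apply/eqP.
apply: (stochastic_ker_im (z := 1%:M - (D - D *m M)) Mst).
  by rewrite mulmxBr mulmxA MQ.
have -> : Q = 1%:M - (D - M *m D) by rewrite e addrK.
rewrite !(mulmxBl, mulmxBr, mulmx1, mul1mx) mulmxA.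
move: (M *m D *m M) (D *m M) (M *m D) => X Y Z.
by apply/matrixP => i j; rewrite !mxE; ring.
Qed.

Lemma Pinf_fixed (R : realType) nS nA (P : mkernel R nS nA) pi p
    (x : 'M[R]_(nS, p)) :
  is_kernel P -> is_policy pi -> Ppi P pi *m x = x -> Pinf P pi *m x = x.
Proof.
move=> Pk pk Mx; have Mst := stochastic_Ppi Pk pk.
have [D [G [MQ e _ _]]] := bias_decomp Pk pk.
apply/eqP; rewrite eq_sym -subr_eq0; apply/eqP.
apply: (stochastic_ker_im (z := D *m x) Mst); first by rewrite mulmxBr mulmxA MQ Mx.
by rewrite -{1}[x]mul1mx e mulmxDl addrC addKr mulmxBl mulmxA.
Qed.

Lemma stochastic_Pinf (R : realType) nS nA (P : mkernel R nS nA) pi :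
  is_kernel P -> is_policy pi -> stochastic (Pinf P pi).
Proof.
move=> Pk pk; have Mst := stochastic_Ppi Pk pk.
have [D [G [MQ e _ _]]] := bias_decomp Pk pk; split=> [i j|i].
  have [c Dc] := stochastic_mulmx_bounded D Mst.
  have cv := @cesaro_telescope R (fun t => (Ppi P pi ^+ t) i j)
    (fun t => (Ppi P pi ^+ t *m D) i j) (Pinf P pi i j) c.
  have {}cv := cv (fun t => _) (fun t => Dc t i j).
  have /cv {}cv : forall t, (Ppi P pi ^+ t) i j = Pinf P pi i j +
      ((Ppi P pi ^+ t *m D) i j - (Ppi P pi ^+ t.+1 *m D) i j).
    move=> t; rewrite {1}(sum_kernel_decomp t MQ e).
    by move: (_ *m D) (_ *m D) (Pinf P pi) => X Y Z; rewrite !mxE.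
  rewrite -(cvg_lim _ cv) //; apply: limr_ge; first exact: cvgP cv.
  apply: nearW => T; rewrite mulr_ge0 // ?invr_ge0 ?ler0n //.
  by apply: sumr_ge0 => t _; have [] := stochastic_exp t Mst.
have := @Pinf_fixed _ _ _ P pi 1 (const_mx 1) Pk pk (stochastic_const _ _ Mst).
move=> /matrixP/(_ i 0); rewrite !mxE => <-.
by apply: eq_bigr => j _; rewrite !mxE mulr1.
Qed.

Lemma gain_fixed (R : realType) nS nA (P : mkernel R nS nA) r pi :
  is_kernel P -> is_policy pi -> Ppi P pi *m gain P r pi = gain P r pi.
Proof.
move=> Pk pk; have [D [G [MQ _ _ _]]] := bias_decomp Pk pk.
by rewrite /gain mulmxA MQ.
Qed.

Lemma poisson (R : realType) nS nA (P : mkernel R nS nA) r pi :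
  is_kernel P -> is_policy pi ->
  rpi r pi = gain P r pi + (bias P r pi - Ppi P pi *m bias P r pi).
Proof.
move=> Pk pk; have [D [G [_ e _ ->]]] := bias_decomp Pk pk.
by rewrite mulmxA -mulmxBl -mulmxDl -e mul1mx.
Qed.

Lemma bias_range (R : realType) nS nA (P : mkernel R nS nA) r pi :
  is_kernel P -> is_policy pi ->
  exists z, bias P r pi = z - Ppi P pi *m z.
Proof.
move=> Pk pk; have [D [G [_ _ DG ->]]] := bias_decomp Pk pk.
by exists (G *m rpi r pi); rewrite {1}DG mulmxBl mulmxA.
Qed.

Lemma rpi_bounds (R : realType) nS nA (r : 'I_nS -> 'I_nA -> R) pi s :
  (forall s a, 0 <= r s a <= 1) -> is_policy pi -> 0 <= rpi r pi s 0 <= 1.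
Proof.
move=> r01 [pi0 pi1]; rewrite mxE; apply/andP; split.
  by apply: sumr_ge0 => a _; rewrite mulr_ge0 //; have /andP[] := r01 s a.
rewrite -(pi1 s); apply: ler_sum => a _.
by rewrite ler_piMr //; have /andP[] := r01 s a.
Qed.

Lemma gain_bounds (R : realType) nS nA (P : mkernel R nS nA) r pi s :
  is_kernel P -> (forall s a, 0 <= r s a <= 1) -> is_policy pi ->
  0 <= gain P r pi s 0 <= 1.
Proof.
move=> Pk r01 pk; have Qst := stochastic_Pinf Pk pk.
have Qc d : (Pinf P pi *m (const_mx d : 'cV[R]_nS)) s 0 = d.
  by rewrite stochastic_const // mxE.
rewrite -{1}(Qc 0) -[X in _ && (_ <= X)](Qc 1).
by apply/andP; split; apply: stochastic_mono => // k; rewrite [const_mx _ _ _]mxE;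
  have /andP[] := rpi_bounds k r01 pk.
Qed.

(** * Discounted values, Bellman optimality and the limit of vanishing discount *)

Definition expect (R : realType) n (p f : 'I_n -> R) : R := \sum_x p x * f x.

Lemma expect_mono (R : realType) n (p f g : 'I_n -> R) :
  (forall x, 0 <= p x) -> (forall x, f x <= g x) -> expect p f <= expect p g.
Proof. by move=> p0 fg; apply: ler_sum => x _; rewrite ler_wpM2l. Qed.

Lemma expect_ge0 (R : realType) n (p f : 'I_n -> R) :
  (forall x, 0 <= p x) -> (forall x, 0 <= f x) -> 0 <= expect p f.
Proof. by move=> p0 f0; apply: sumr_ge0 => x _; rewrite mulr_ge0. Qed.

Lemma expect_const (R : realType) n (p : 'I_n -> R) c :
  \sum_x p x = 1 -> expect p (fun=> c) = c.
Proof. by move=> p1; rewrite /expect -mulr_suml p1 mul1r. Qed.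

Lemma expectD (R : realType) n (p f g : 'I_n -> R) :
  expect p (fun x => f x + g x) = expect p f + expect p g.
Proof. by rewrite -big_split; apply: eq_bigr => x _; rewrite mulrDr. Qed.

Lemma expectZ (R : realType) n (p f : 'I_n -> R) c :
  expect p (fun x => c * f x) = c * expect p f.
Proof. by rewrite mulr_sumr; apply: eq_bigr => x _; rewrite mulrCA. Qed.

Lemma eq_expect (R : realType) n (p f g : 'I_n -> R) :
  (forall x, f x = g x) -> expect p f = expect p g.
Proof. by move=> fg; apply: eq_bigr => x _; rewrite fg. Qed.

Lemma Ppi_mulE (R : realType) nS nA (P : mkernel R nS nA) pi (V : 'cV[R]_nS) s :
  (Ppi P pi *m V) s 0 = \sum_a pi s a * expect (P s a) (V^~ 0).
Proof.
rewrite mxE; under eq_bigr do rewrite mxE mulr_suml.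
rewrite exchange_big /=; apply: eq_bigr => a _.
by rewrite mulr_sumr; apply: eq_bigr => x _; rewrite mulrA.
Qed.

Lemma sum_of_det (R : realType) nS nA (d : det_policy nS nA) s (F : 'I_nA -> R) :
  \sum_a of_det d s a * F a = F (d s).
Proof.
rewrite (bigD1 (d s)) //= /of_det eqxx mul1r big1 ?addr0 // => a ad.
by rewrite eq_sym (negbTE ad) mul0r.
Qed.

Lemma is_policy_of_det (R : realType) nS nA (d : det_policy nS nA) :
  is_policy (of_det d : policy R nS nA).
Proof.
split=> [s a|s]; first exact: ler0n.
rewrite -[RHS](sum_of_det d s (fun=> 1)).
by apply: eq_bigr => a _; rewrite mulr1.
Qed.

Lemma Ppi_of_detE (R : realType) nS nA (P : mkernel R nS nA) d (V : 'cV[R]_nS) s :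
  (Ppi P (of_det d) *m V) s 0 = expect (P s (d s)) (V^~ 0).
Proof. by rewrite Ppi_mulE sum_of_det. Qed.

Lemma rpi_of_detE (R : realType) nS nA (r : 'I_nS -> 'I_nA -> R) d s :
  rpi r (of_det d) s 0 = r s (d s).
Proof. by rewrite mxE sum_of_det. Qed.

(** Maximum principle at a state maximising [x], where [M *m x] is at most [x]. It yields
    invertibility and the comparison of a value with super- and subsolutions. *)
Lemma discounted_le (R : realType) n (M : 'M[R]_n) (x : 'cV[R]_n) g b :
  stochastic M -> 0 <= g < 1 -> (forall s, x s 0 <= g * (M *m x) s 0 + b) ->
  forall s, x s 0 <= b / (1 - g).
Proof.
move=> Mst /andP[g0 g1] xM s0.
case: (@arg_maxP _ R 'I_n s0 predT (fun i => x i 0)) => // s _ smax.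
apply: le_trans (smax s0 isT) _; rewrite ler_pdivlMr ?subr_gt0 //.
have : (M *m x) s 0 <= x s 0.
  have -> : x s 0 = (M *m (const_mx (x s 0) : 'cV[R]_n)) s 0.
    by rewrite stochastic_const // mxE.
  by apply: stochastic_mono => // k; rewrite mxE; exact: smax.
by move=> /(ler_wpM2l g0); have := xM s; lra.
Qed.

Lemma unit_discounted (R : realType) n (M : 'M[R]_n) g :
  stochastic M -> 0 <= g < 1 -> 1%:M - g *: M \in unitmx.
Proof.
move=> Mst g01; rewrite -unitmx_tr -row_free_unit; apply/inj_row_free => v vA.
have Av : v^T = g *: (M *m v^T).
  apply/eqP; rewrite -subr_eq0 scalemxAl -{1}[v^T]mul1mx -mulmxBl.
  by rewrite -[1%:M - _]trmxK -trmx_mul vA trmx0.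
apply: trmx_inj; apply/colP => s; rewrite trmx0 [RHS]mxE.
apply/eqP; rewrite eq_le -oppr_le0 -(mul0r (1 - g)^-1).
have vE k : v^T k 0 = g * (M *m v^T) k 0 by rewrite {1}Av mxE.
rewrite (discounted_le (M := M)) //=; last by move=> k; rewrite vE addr0.
rewrite -opp_mxE.
apply: (discounted_le (M := M)) => // k.
by rewrite mulmxN addr0 !opp_mxE mulrN -vE.
Qed.

Lemma Vpi_eq (R : realType) nS nA (P : mkernel R nS nA) r pi g s :
  is_kernel P -> is_policy pi -> 0 <= g < 1 ->
  Vpi P r pi g s 0 = rpi r pi s 0 + g * (Ppi P pi *m Vpi P r pi g) s 0.
Proof.
move=> Pk pk g01.
have := mulKVmx (unit_discounted (stochastic_Ppi Pk pk) g01) (rpi r pi).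
rewrite -/(Vpi P r pi g) mulmxBl mul1mx -scalemxAl => /colP/(_ s).
by move: (_ *m _) => X; rewrite !mxE => <-; rewrite subrK.
Qed.

Lemma Vpi_le (R : realType) nS nA (P : mkernel R nS nA) r pi g (V : 'cV[R]_nS) :
  is_kernel P -> is_policy pi -> 0 <= g < 1 ->
  (forall s, rpi r pi s 0 + g * (Ppi P pi *m V) s 0 <= V s 0) ->
  forall s, Vpi P r pi g s 0 <= V s 0.
Proof.
move=> Pk pk g01 VP s; rewrite -subr_le0.
rewrite -sub_mxE -(mul0r (1 - g)^-1).
apply: (discounted_le (stochastic_Ppi Pk pk)) => // k; rewrite addr0 mulmxBr.
by rewrite !sub_mxE Vpi_eq //; have := VP k; lra.
Qed.

Lemma Vpi_ge (R : realType) nS nA (P : mkernel R nS nA) r pi g (V : 'cV[R]_nS) :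
  is_kernel P -> is_policy pi -> 0 <= g < 1 ->
  (forall s, V s 0 <= rpi r pi s 0 + g * (Ppi P pi *m V) s 0) ->
  forall s, V s 0 <= Vpi P r pi g s 0.
Proof.
move=> Pk pk g01 VP s; rewrite -subr_le0.
rewrite -sub_mxE -(mul0r (1 - g)^-1).
apply: (discounted_le (stochastic_Ppi Pk pk)) => // k; rewrite addr0 mulmxBr.
by rewrite !sub_mxE Vpi_eq //; have := VP k; lra.
Qed.

(** A maximiser of the sum of the values over all states works: a violation at [(s, a)] would allow
    a switch to [a] at [s] alone, raising all values weakly and the one at [s] strictly. *)
Lemma exists_optimal_det (R : realType) nS nA (P : mkernel R nS nA) r g
    (d0 : det_policy nS nA) :
  is_kernel P -> 0 <= g < 1 ->
  exists d : det_policy nS nA, forall s a,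
    r s a + g * expect (P s a) ((Vpi P r (of_det d) g)^~ 0)
      <= Vpi P r (of_det d) g s 0.
Proof.
move=> Pk g01; have /andP[g0 g1] := g01.
case: (@arg_maxP _ R {ffun 'I_nS -> 'I_nA} (finfun d0) predT
  (fun d => \sum_s Vpi P r (of_det d) g s 0)) => // d _ dmax.
exists d => s a; rewrite leNgt; apply/negP => lt.
pose d' : {ffun 'I_nS -> 'I_nA} := [ffun x => if x == s then a else d x].
have pk (e : det_policy nS nA) := is_policy_of_det R e.
have V'_ge x : Vpi P r (of_det d) g x 0 <= Vpi P r (of_det d') g x 0.
  apply: Vpi_ge => // y; rewrite rpi_of_detE Ppi_of_detE ffunE.
  case: eqP => [->|_]; first exact: ltW.
  by rewrite {1}Vpi_eq // rpi_of_detE Ppi_of_detE.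
have V'_gt : Vpi P r (of_det d) g s 0 < Vpi P r (of_det d') g s 0.
  apply: (lt_le_trans lt); rewrite [leRHS]Vpi_eq // rpi_of_detE Ppi_of_detE.
  rewrite ffunE eqxx lerD2l ler_wpM2l //; apply: expect_mono => //.
  by case: Pk.
have : \sum_x Vpi P r (of_det d') g x 0 <= \sum_x Vpi P r (of_det d) g x 0.
  exact: dmax.
rewrite leNgt => /negP; apply.
rewrite (bigD1 s) //= [ltRHS](bigD1 s) //=.
by apply: ltr_leD => //; apply: ler_sum.
Qed.

Lemma Vpi_le_bellman (R : realType) nS nA (P : mkernel R nS nA) r pi g
    (V : 'cV[R]_nS) :
  is_kernel P -> is_policy pi -> 0 <= g < 1 ->
  (forall s a, r s a + g * expect (P s a) (V^~ 0) <= V s 0) ->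
  forall s, Vpi P r pi g s 0 <= V s 0.
Proof.
move=> Pk pk g01 VP; apply: Vpi_le => // s.
rewrite mxE Ppi_mulE mulr_sumr -big_split /=.
have [pi0 pi1] := pk; rewrite -[leRHS]mul1r -(pi1 s) mulr_suml.
apply: ler_sum => a _; rewrite mulrCA -mulrDr ler_wpM2l //.
Qed.

Lemma sup_eq_max (R : realType) (A : set R) m :
  A m -> (forall x, A x -> x <= m) -> sup A = m.
Proof.
move=> Am ubm; apply/eqP; rewrite eq_le; apply/andP; split.
  by apply: ge_sup => //; exists m.
by apply: ub_le_sup => //; exists m.
Qed.

Lemma Vstar_eq (R : realType) nS nA (P : mkernel R nS nA) r g d :
  (forall pi, is_policy pi -> forall s,
     Vpi P r pi g s 0 <= Vpi P r (of_det d) g s 0) ->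
  Vstar P r g = Vpi P r (of_det d) g.
Proof.
move=> opt; apply/colP => s; rewrite mxE; apply: sup_eq_max.
  by exists (of_det d) => //; exact: is_policy_of_det.
by move=> _ [pi pk <-]; exact: opt.
Qed.

Lemma Vstar_optimal (R : realType) nS nA (P : mkernel R nS nA) r g
    (d0 : det_policy nS nA) : is_kernel P -> 0 <= g < 1 ->
  exists d, Vstar P r g = Vpi P r (of_det d) g /\
  forall s a, r s a + g * expect (P s a) ((Vstar P r g)^~ 0) <= Vstar P r g s 0.
Proof.
move=> Pk g01; have [d dopt] := exists_optimal_det r d0 Pk g01.
have VE : Vstar P r g = Vpi P r (of_det d) g.
  by apply: Vstar_eq => pi pk; exact: Vpi_le_bellman.
by exists d; rewrite VE.
Qed.

Lemma Vpi_bounds (R : realType) nS nA (P : mkernel R nS nA) r pi g s :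
  is_kernel P -> is_policy pi -> 0 <= g < 1 -> (forall s a, 0 <= r s a <= 1) ->
  0 <= Vpi P r pi g s 0 <= (1 - g)^-1.
Proof.
move=> Pk pk g01 r01; have /andP[g0 g1] := g01.
have Mst := stochastic_Ppi Pk pk.
have cE (c : R) k : (const_mx c : 'cV[R]_nS) k 0 = c by rewrite mxE.
rewrite -{1}(cE 0 s) -[X in _ && (_ <= X)](cE _ s); apply/andP; split.
  apply: Vpi_ge => // k; rewrite stochastic_const // !cE mulr0 addr0.
  by have /andP[] := rpi_bounds k r01 pk.
apply: Vpi_le => // k; rewrite stochastic_const // !cE.
have /andP[_ r1] := rpi_bounds k r01 pk; apply: le_trans (lerD r1 (lexx _)) _.
have h : 1 - g != 0 by rewrite subr_eq0 gt_eqF.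
suff -> : 1 + g * (1 - g)^-1 = (1 - g)^-1 by [].
by field.
Qed.

(* With [bias = z - M z], the vectors
   gain/(1-g) + bias + (1-g)(+-c - M z), where |M^2 z| <= c,
   are a super- and a subsolution of the evaluation equation. *)
Lemma Vpi_laurent (R : realType) nS nA (P : mkernel R nS nA) r pi :
  is_kernel P -> is_policy pi -> exists c, 0 <= c /\
  forall g, 0 <= g < 1 -> forall s,
    `|Vpi P r pi g s 0 - gain P r pi s 0 / (1 - g) - bias P r pi s 0|
      <= c * (1 - g).
Proof.
move=> Pk pk; have Mst := stochastic_Ppi Pk pk.
have [z hz] := bias_range r Pk pk.
have rE := poisson r Pk pk; have Mrho := gain_fixed r Pk pk.
set M := Ppi P pi in Mst hz rE Mrho.
set rho := gain P r pi in rE Mrho *; set h := bias P r pi in hz rE *.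
have [c [c0 zc]] := mx_bounded z.
have zMc s : `|(M *m z) s 0| <= c by exact: stochastic_norm.
have zMMc s : `|(M *m (M *m z)) s 0| <= c by exact: stochastic_norm.
exists (2 * c); split=> [|g g01 s]; first by rewrite mulr_ge0.
have /andP[g0 g1] := g01.
pose U (x : R) : 'cV[R]_nS := (1 - g)^-1 *: rho + h + (1 - g) *: (const_mx x - M *m z).
have UE x k : U x k 0 = rho k 0 / (1 - g) + h k 0 + (1 - g) * (x - (M *m z) k 0).
  rewrite /U; move: (M *m z) => w; rewrite !mxE; by rewrite [_^-1 * _]mulrC.
have step x k : U x k 0 - (rpi r pi k 0 + g * (M *m U x) k 0)
    = (1 - g) ^+ 2 * (x - (M *m (M *m z)) k 0).
  rewrite UE rE /U !mulmxDr -!scalemxAr Mrho mulmxBr stochastic_const // hz.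
  rewrite mulmxBr; move: (M *m (M *m z)) (M *m z) => w2 w1.
  clearbody rho; rewrite !mxE; field; by rewrite subr_eq0 gt_eqF.
have up : Vpi P r pi g s 0 <= U c s 0.
  apply: Vpi_le => // k; rewrite -subr_ge0 step mulr_ge0 ?sqr_ge0 //.
  by rewrite subr_ge0; have := zMMc k; rewrite ler_norml => /andP[].
have lo : U (- c) s 0 <= Vpi P r pi g s 0.
  apply: Vpi_ge => // k; rewrite -subr_le0 step mulr_ge0_le0 ?sqr_ge0 //.
  by rewrite subr_le0; have := zMMc k; rewrite ler_norml => /andP[].
have := zMc s; rewrite ler_norml => /andP[z1 z2].
have k1 : (1 - g) * (c - (M *m z) s 0) <= (1 - g) * (2 * c).
  by rewrite ler_wpM2l ?subr_ge0 ?(ltW g1) //; lra.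
have k2 : (1 - g) * (- (2 * c)) <= (1 - g) * (- c - (M *m z) s 0).
  by rewrite ler_wpM2l ?subr_ge0 ?(ltW g1) //; lra.
rewrite UE in up; rewrite UE in lo.
by rewrite ler_norml; apply/andP; split; lra.
Qed.

Lemma le0_of_discount_limit (R : realType) (x c gbar : R) : gbar < 1 ->
  (forall g, gbar <= g -> 0 < g -> g < 1 -> x <= c * (1 - g)) -> x <= 0.
Proof.
move=> gb1 xc; rewrite leNgt; apply/negP => x0.
have c1 : 0 < `|c| + 1 by rewrite ltr_wpDl.
(* For [g = 1 - e]: the first bound gives [0 < g], the second [gbar <= g], the third
   [c * e <= x / 2]. *)
pose e := Num.min (2^-1) (Num.min (1 - gbar) (x / (2 * (`|c| + 1)))).
have e0 : 0 < e.
  by rewrite !lt_min invr_gt0 ltr0n subr_gt0 gb1 divr_gt0 // mulr_gt0.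
have e1 : e <= 2^-1 by rewrite ge_min lexx.
have e2 : e <= 1 - gbar by rewrite !ge_min lexx orbT.
have e3 : e <= x / (2 * (`|c| + 1)) by rewrite !ge_min lexx !orbT.
have h2 : (2^-1 : R) < 1 by rewrite invf_lt1 // ltr1n.
clearbody e; have h : x <= c * e.
  by rewrite (_ : e = 1 - (1 - e)); [apply: xc; lra | ring].
have : e * (2 * (`|c| + 1)) <= x by rewrite -ler_pdivlMr // mulr_gt0.
have : c * e <= `|c| * e by rewrite ler_wpM2r ?(ltW e0) // ler_norm.
have : 0 <= `|c| * e by rewrite mulr_ge0 // ltW.
lra.
Qed.

Lemma gain_le_of_Vpi (R : realType) nS nA (P : mkernel R nS nA) r pi1 pi2 gbar s :
  is_kernel P -> is_policy pi1 -> is_policy pi2 -> gbar < 1 ->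
  (forall g, gbar <= g -> 0 < g -> g < 1 ->
     Vpi P r pi1 g s 0 <= Vpi P r pi2 g s 0) ->
  gain P r pi1 s 0 <= gain P r pi2 s 0.
Proof.
move=> Pk p1 p2 gb V12; rewrite -subr_le0.
have [c1 [c10 h1]] := Vpi_laurent r Pk p1.
have [c2 [c20 h2]] := Vpi_laurent r Pk p2.
apply: (@le0_of_discount_limit _ _
  (`|bias P r pi1 s 0| + `|bias P r pi2 s 0| + c1 + c2) _ gb) => g gg g0 g1.
have g01 : 0 <= g < 1 by rewrite ltW.
have := h1 g g01 s; rewrite ler_norml => /andP[h1' _].
have := h2 g g01 s; rewrite ler_norml => /andP[_ h2'].
have V12' := V12 g gg g0 g1.
have b1 : - `|bias P r pi1 s 0| <= bias P r pi1 s 0 by rewrite lerNl ler_normr lexx orbT.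
have b2 := ler_norm (bias P r pi2 s 0).
have i0 : 0 < 1 - g by rewrite subr_gt0.
have c1g : c1 * (1 - g) <= c1 by rewrite ler_piMr //; lra.
have c2g : c2 * (1 - g) <= c2 by rewrite ler_piMr //; lra.
rewrite -ler_pdivrMr // mulrBl; lra.
Qed.

Lemma blackwell_gain_optimal (R : realType) nS nA (P : mkernel R nS nA) r d pi s :
  is_kernel P -> blackwell_optimal P r d -> is_policy pi ->
  gain P r pi s 0 <= gain P r (of_det d) s 0.
Proof.
move=> Pk [gb [gb1 opt]] pk.
apply: (gain_le_of_Vpi Pk pk (is_policy_of_det R d) gb1) => g gg g0 g1.
exact: opt.
Qed.

Lemma blackwell_Vstar (R : realType) nS nA (P : mkernel R nS nA) r d :
  blackwell_optimal P r d -> exists gbar : R, gbar < 1 /\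
  forall g, gbar <= g -> 0 < g -> g < 1 -> Vstar P r g = Vpi P r (of_det d) g.
Proof.
move=> [gb [gb1 opt]]; exists gb; split=> // g gg g0 g1.
by apply: Vstar_eq => pi pk s; exact: opt.
Qed.

(** In the Bellman inequality, expanded by [Vpi_laurent] on both sides, all terms but those in
    [1 / (1 - g)] stay bounded as [g] tends to 1, so the coefficients of the latter are ordered. *)
Lemma blackwell_gain_superharmonic (R : realType) nS nA (P : mkernel R nS nA) r d s a :
  is_kernel P -> blackwell_optimal P r d ->
  expect (P s a) ((gain P r (of_det d))^~ 0) <= gain P r (of_det d) s 0.
Proof.
move=> Pk bo; have [gb [gb1 VE]] := blackwell_Vstar bo.
have pk := is_policy_of_det R d; rewrite -subr_le0.
have [c [c0 hc]] := Vpi_laurent r Pk pk.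
set rho := gain P r (of_det d) in hc *; set h := bias P r (of_det d) in hc.
set E := expect (P s a) (rho^~ 0); set Eh := expect (P s a) (h^~ 0).
apply: (@le0_of_discount_limit _ _
  (`|h s 0| + `|Eh| + `|r s a| + `|E| + c + c) _ gb1) => g gg g0 g1.
have g01 : 0 <= g < 1 by rewrite ltW.
have i0 : 0 < 1 - g by rewrite subr_gt0.
have [d' [_ /(_ s a)]] := Vstar_optimal r d Pk g01; rewrite VE // => bell.
have := hc g g01 s; rewrite ler_norml => /andP[_ hs].
have hE : E / (1 - g) + Eh - c * (1 - g) <= expect (P s a) ((Vpi P r (of_det d) g)^~ 0).
  have [P0 P1] := Pk; rewrite -(expect_const (- (c * (1 - g))) (P1 s a)) mulrC -expectZ.
  rewrite -!expectD; apply: expect_mono => // k.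
  have := hc g g01 k; rewrite ler_norml => /andP[+ _].
  by rewrite [_ * rho _ _]mulrC; lra.
have {hE bell} hm := le_trans (lerD (lexx (r s a)) (ler_wpM2l (ltW g0) hE)) bell.
have cg : c * (1 - g) <= c by rewrite ler_piMr //; lra.
have cg0 : 0 <= c * (1 - g) by rewrite mulr_ge0 // ltW.
have gcg : g * (c * (1 - g)) <= c * (1 - g) by rewrite ler_piMl // ltW.
have n1 := ler_norm (h s 0).
have n2 : - `|Eh| <= g * Eh.
  by rewrite lerNl -mulrN (le_trans (ler_norm _)) // normrM normrN
     ger0_norm ?ler_piMl // ltW.
have n3 : - `|r s a| <= r s a by rewrite lerNl ler_normr lexx orbT.
have n4 := ler_norm E.
have gE : g * (E / (1 - g)) = E / (1 - g) - E by field; lra.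
rewrite -ler_pdivrMr // mulrBl; lra.
Qed.

(** * Closed sets, recurrence and constancy of the optimal gain *)

Lemma sum_gt0_ex (R : realType) (I : finType) (F : I -> R) :
  0 < \sum_i F i -> exists i, 0 < F i.
Proof.
move=> F0; apply: contrapT => nex; move: F0; apply/negP; rewrite -leNgt.
by apply: sumr_le0 => i _; rewrite leNgt; apply/negP => Fi; apply: nex; exists i.
Qed.

(** The gap [m - f] is nonnegative with nonpositive mean, so it vanishes wherever [p] is positive.
    This is what makes the sets of extremal gain closed under transitions. *)
Lemma expect_eq_max (R : realType) n (p f : 'I_n -> R) m x :
  (forall k, 0 <= p k) -> \sum_k p k = 1 -> (forall k, f k <= m) ->
  m <= expect p f -> 0 < p x -> f x = m.
Proof.
move=> p0 p1 fm mE px; apply/eqP; rewrite eq_le fm /=.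
have : p x * (m - f x) <= 0.
  apply: (@le_trans _ _ (\sum_k p k * (m - f k))).
    rewrite (bigD1 x) //= lerDl; apply: sumr_ge0 => k _.
    by rewrite mulr_ge0 // subr_ge0.
  have -> : \sum_k p k * (m - f k) = m - expect p f.
    rewrite -[m in RHS](expect_const m p1) /expect -sumrB.
    by apply: eq_bigr => k _; rewrite mulrBr.
  by rewrite subr_le0.
by rewrite pmulr_rle0 // subr_le0.
Qed.

Definition closed_set (R : realType) n (M : 'M[R]_n) (K : 'I_n -> Prop) :=
  forall s x, K s -> 0 < M s x -> K x.

Lemma closed_set_exp (R : realType) n (M : 'M[R]_n) K t s x :
  stochastic M -> closed_set M K -> K s -> 0 < (M ^+ t) s x -> K x.
Proof.
move=> Mst Kc; elim: t s => [|t IH] s Ks.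
  by rewrite expr0 mxE; case: eqP => [<-//|_]; rewrite ltxx.
rewrite exprS mxE => /sum_gt0_ex[k Hk].
have [M0 _] := Mst; have [Mt0 _] := stochastic_exp t Mst.
have Mk : 0 < M s k.
  by rewrite lt_neqAle M0 andbT; apply/eqP => e; move: Hk; rewrite -e mul0r ltxx.
by apply: (IH k); [exact: Kc Ks Mk | move: Hk; rewrite pmulr_rgt0].
Qed.

Lemma Pinf_closed_set (R : realType) nS nA (P : mkernel R nS nA) pi K s x :
  is_kernel P -> is_policy pi -> closed_set (Ppi P pi) K -> K s -> ~ K x ->
  Pinf P pi s x = 0.
Proof.
move=> Pk pk Kc Ks Kx; have Mst := stochastic_Ppi Pk pk; rewrite mxE.
apply: (@cesaro_eq _ _ (fun=> 0) _ 0) => t; last by rewrite normr0.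
rewrite subrr addr0; apply/eqP; rewrite eq_sym eq_le.
have [-> _] := stochastic_exp t Mst; rewrite leNgt; apply/negP => h.
exact: Kx (closed_set_exp Mst Kc Ks h).
Qed.

(** By [sum_kernel_decomp] the expected number of visits before [T] is [T * Pinf s s] up to a
    bounded term. *)
Lemma transient_Pinf0 (R : realType) nS nA (P : mkernel R nS nA) pi s :
  is_kernel P -> is_policy pi -> transient (Ppi P pi) s -> Pinf P pi s s = 0.
Proof.
move=> Pk pk [B hB]; have Mst := stochastic_Ppi Pk pk.
have [Q0 _] := stochastic_Pinf Pk pk.
have [D [_ [MQ e _ _]]] := bias_decomp Pk pk.
have [c Dc] := stochastic_mulmx_bounded D Mst.
have sumE T : \sum_(t < T) (Ppi P pi ^+ t) s s
    = T%:R * Pinf P pi s s + (D s s - (Ppi P pi ^+ T *m D) s s).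
  elim: T => [|T IH]; first by rewrite big_ord0 expr0 mul1mx mul0r subrr addr0.
  rewrite big_ord_recr /= IH {2}(sum_kernel_decomp T MQ e) -natr1.
  by rewrite add_mxE sub_mxE; ring.
apply/eqP; rewrite eq_le Q0 andbT leNgt; apply/negP => q0.
set q := Pinf P pi s s in q0 sumE.
have := hB (Num.truncn ((B + 2 * c) / q)).+1; rewrite sumE => h.
have := truncnS_gt ((B + 2 * c) / q); rewrite ltr_pdivrMr // => h'.
have := Dc 0%N s s; rewrite expr0 mul1mx ler_norml => /andP[d1 _].
have := Dc (Num.truncn ((B + 2 * c) / q)).+1 s s.
rewrite ler_norml => /andP[_ d2]; clear - h h' d1 d2; lra.
Qed.

(* x |-> Pinf x s is harmonic, and its argmax set is closed: if it avoided s,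
   s would never be visited from it. So s itself is an argmax. *)
Lemma closed_set_recurrent (R : realType) nS nA (P : mkernel R nS nA) pi K s0 :
  is_kernel P -> is_policy pi -> closed_set (Ppi P pi) K -> K s0 ->
  exists s, K s /\ ~ transient (Ppi P pi) s.
Proof.
move=> Pk pk Kc Ks0; apply: contrapT => nex.
have Mst := stochastic_Ppi Pk pk; have [M0 M1] := Mst.
have [Q0 Q1] := stochastic_Pinf Pk pk.
have [D [_ [MQ _ _ _]]] := bias_decomp Pk pk.
have tr s : K s -> Pinf P pi s s = 0.
  move=> Ks; apply: transient_Pinf0 => //; apply: contrapT => h.
  by apply: nex; exists s.
suff h s : Pinf P pi s0 s = 0.
  have := Q1 s0; rewrite big1 => [|s _]; last exact: h.
  by move/eqP; rewrite eq_sym oner_eq0.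
have [Ks|Ks] := pselect (K s); last exact: Pinf_closed_set Ks0 Ks.
apply/eqP; rewrite eq_le Q0 andbT.
case: (@arg_maxP _ R 'I_nS s0 predT (fun x => Pinf P pi x s)) => // m _ mmax.
apply: le_trans (mmax s0 isT) _; rewrite leNgt; apply/negP => m0.
have Nc : closed_set (Ppi P pi) (fun x => Pinf P pi x s = Pinf P pi m s).
  move=> x y xm xy.
  apply: (@expect_eq_max _ _ (Ppi P pi x) (fun x => Pinf P pi x s)) xy => //.
    by move=> k; exact: mmax.
  by rewrite -{1}xm -{1}MQ mxE.
have := Pinf_closed_set Pk pk Nc (erefl (Pinf P pi m s)) (x := s).
rewrite tr // => h; have {}h : Pinf P pi m s = 0.
  by apply: h => e; move: m0; rewrite -e ltxx.
by move: m0; rewrite h ltxx.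
Qed.

(** The gain is harmonic for the optimal chain, so its argmax set is closed there and contains a
    recurrent state [x], which lies in [Cl]. It is superharmonic for every action, so its argmin set
    is closed under every policy and contains some [y] in [Cl]. A policy leading from [y] to [x]
    never leaves the argmin set, so maximum and minimum coincide. *)
Lemma wcomm_gain_constant (R : realType) nS nA (P : mkernel R nS nA) r d s s' :
  is_kernel P -> weakly_communicating P -> blackwell_optimal P r d ->
  gain P r (of_det d) s 0 = gain P r (of_det d) s' 0.
Proof.
move=> Pk [Tr [Cl [_ [TC [Trt Clr]]]]] bo; have pk := is_policy_of_det R d.
have [P0 P1] := Pk; have Mst := stochastic_Ppi Pk pk; have [M0 M1] := Mst.
set rho := gain P r (of_det d).
have rhoE x : expect (Ppi P (of_det d) x) (rho^~ 0) = rho x 0.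
  by rewrite -[in RHS]/rho; have /colP/(_ x) <- := gain_fixed r Pk pk; rewrite mxE.
have inCl x : ~ transient (Ppi P (of_det d)) x -> x \in Cl.
  move=> nt; have : x \in (Tr :|: Cl)%SET by rewrite TC finset.in_setT.
  by rewrite finset.in_setU => /orP[/Trt/(_ _ pk)//|].
case: (@arg_maxP _ R 'I_nS s predT (fun x => rho x 0)) => // m _ mmax.
case: (@arg_maxP _ R 'I_nS s predT (fun x => - rho x 0)) => // l _ lmin.
have Kmax : closed_set (Ppi P (of_det d)) (fun x => rho x 0 = rho m 0).
  move=> x y xm xy.
  apply: (@expect_eq_max _ _ (Ppi P (of_det d) x) (rho^~ 0)) xy => //.
    by move=> k; exact: mmax.
  by rewrite rhoE xm.
have Kmin pi : is_policy pi -> closed_set (Ppi P pi) (fun x => rho x 0 = rho l 0).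
  move=> [pi0 pi1] x y xl; rewrite mxE => /sum_gt0_ex[a Ha].
  have Pxy : 0 < P x a y.
    rewrite lt_neqAle P0 andbT; apply/eqP => e.
    by move: Ha; rewrite -e mulr0 ltxx.
  apply: oppr_inj.
  apply: (@expect_eq_max _ _ (P x a) (fun k => - rho k 0)) Pxy => //.
    by move=> k; exact: lmin.
  have := blackwell_gain_superharmonic x a Pk bo; rewrite -/rho xl -lerN2.
  suff -> : expect (P x a) (fun k => - rho k 0) = - expect (P x a) (rho^~ 0) by [].
  by rewrite -mulN1r -expectZ; apply: eq_expect => k; rewrite mulN1r.
have [x [xm xnt]] := closed_set_recurrent Pk pk Kmax (erefl (rho m 0)).
have [y [yl ynt]] := closed_set_recurrent Pk pk (Kmin _ pk) (erefl (rho l 0)).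
have [pi [pik [t yx]]] := Clr y x (inCl y ynt) (inCl x xnt).
have xl : rho x 0 = rho l 0.
  exact: closed_set_exp (stochastic_Ppi Pk pik) (Kmin pi pik) yl yx.
have E k : rho k 0 = rho l 0.
  apply/eqP; rewrite eq_le -{1}xl xm -[_ <= rho k 0]lerN2.
  by apply/andP; split; [exact: mmax | exact: lmin].
by rewrite !E.
Qed.

(** * The threshold discount and the span seminorm *)

Lemma supnorm_le (R : realType) n (x : 'cV[R]_n) c :
  0 <= c -> (forall s, `|x s 0| <= c) -> supnorm x <= c.
Proof. by move=> c0 xc; apply: bigmax_le => // s _; exact: xc. Qed.

Lemma le_supnorm (R : realType) n (x : 'cV[R]_n) s : `|x s 0| <= supnorm x.
Proof. exact: (le_bigmax _ (fun s => `|x s 0|)). Qed.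

(** As the gain is constant, [Vpi_laurent] puts [Vstar] within [c * (1 - g)] of the bias plus a
    constant vector, so the set of thresholds is nonempty. The inequality [ghat < g] is strict
    because attainment of the infimum is not established. *)
Lemma gamma_hat_star_spec (R : realType) nS nA (P : mkernel R nS nA) r d n :
  is_kernel P -> (0 < n)%N -> weakly_communicating P -> blackwell_optimal P r d ->
  let ghat := gamma_hat_star P r (bias P r (of_det d)) n in
  0 <= ghat < 1 /\
  forall g, ghat < g -> g < 1 ->
    exists c, forall s, `|Vstar P r g s 0 - bias P r (of_det d) s 0 - c| <= n%:R^-1.
Proof.
move=> Pk n0 wc bo; have pk := is_policy_of_det R d.
have n0' : 0 < n%:R^-1 :> R by rewrite invr_gt0 ltr0n.
rewrite /gamma_hat_star; set h := bias P r (of_det d); set A := [set gbar : R | _]%classic.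
set ghat := inf A.
have [g1 Ag1] : (A !=set0)%classic.
  have [gb [gb1 VE]] := blackwell_Vstar bo.
  have [c [c0 hc]] := Vpi_laurent r Pk pk.
  have c1 : 0 < c + 1 by rewrite ltr_wpDl.
  have e0 : 0 < n%:R^-1 / (c + 1) by rewrite divr_gt0.
  pose g1 := Num.max (2^-1) (Num.max gb (1 - n%:R^-1 / (c + 1))).
  have g1a : 2^-1 <= g1 by rewrite le_max lexx.
  have g1b : gb <= g1 by rewrite !le_max lexx orbT.
  have g1c : 1 - n%:R^-1 / (c + 1) <= g1 by rewrite !le_max lexx !orbT.
  have h2 : 0 < (2^-1 : R) by rewrite invr_gt0.
  have g11 : g1 < 1.
    by rewrite !gt_max invf_lt1 ?ltr1n //= gb1 /= ltrBlDr ltrDl.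
  clearbody g1; exists g1; split; [lra|split=> // g gg glt].
  have [s0|noS] := pselect (exists s : 'I_nS, True); last first.
    exists 0; apply: supnorm_le; first exact: ltW.
    by move=> s; case: noS; exists s.
  have [s _] := s0.
  exists (gain P r (of_det d) s 0 / (1 - g)); apply: supnorm_le; first exact: ltW.
  move=> x; rewrite VE; [|lra..].
  rewrite !sub_mxE [X in _ - _ - X]mxE [const_mx _ _ _]mxE mulr1.
  have g01 : 0 <= g < 1 by apply/andP; split; lra.
  rewrite (wcomm_gain_constant s x Pk wc bo) addrAC.
  apply: le_trans (hc g g01 x) _.
  have : 1 - g <= n%:R^-1 / (c + 1) by lra.
  rewrite ler_pdivlMr // => k; nra.
have lbA : has_lbound A by exists 0 => x [].
have hinf : has_inf A by split=> //; exists g1.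
have ge0 : 0 <= ghat by apply: lb_le_inf; [exists g1 | move=> x []].
have lt1 : ghat < 1 by apply: (le_lt_trans (ge_inf lbA Ag1)); case: Ag1 => _ [].
split=> [|g gg glt]; first by rewrite ge0.
have [x Ax xg] : exists2 x, A x & x < g by apply: inf_lt => //; exists g1.
have [_ [_ /(_ g (ltW xg) glt)[c hc]]] := Ax.
exists c => s; apply: le_trans hc; apply: le_trans (le_supnorm _ s).
by rewrite !sub_mxE [X in _ <= `|_ - X|]mxE [const_mx _ _ _]mxE mulr1.
Qed.

Lemma spnorm_ge (R : realType) n (x : 'cV[R]_n) s s' :
  x s 0 - x s' 0 <= spnorm x.
Proof.
have [c [_ xc]] := mx_bounded x; rewrite /spnorm lerB //.
  apply: ub_le_sup; last by exists s.
  by exists c => _ [k _ <-]; rewrite (le_trans (ler_norm _)).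
apply: ge_inf; last by exists s'.
exists (- c) => _ [k _ <-]; have := xc k 0.
by rewrite ler_norml => /andP[].
Qed.

Lemma spnorm_le (R : realType) n (x : 'cV[R]_n) (s0 : 'I_n) c :
  (forall s s', x s 0 - x s' 0 <= c) -> spnorm x <= c.
Proof.
move=> xc; rewrite /spnorm lerBlDr.
apply: ge_sup; first by exists (x s0 0), s0.
move=> _ [s _ <-]; rewrite -lerBlDl.
apply: lb_le_inf; first by exists (x s0 0), s0.
by move=> _ [s' _ <-]; have := xc s s'; lra.
Qed.

(** * The sample space and exponential tests *)

Definition sample_set nS nA n (w : msample nS nA n) k x : msample nS nA n :=
  [ffun j => if j == k then x else w j].

Definition sexpect (R : realType) nS nA n (P : mkernel R nS nA)
  (G : msample nS nA n -> R) : R := \sum_w sample_prob P w * G w.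

Lemma sample_prob_ge0 (R : realType) nS nA n (P : mkernel R nS nA)
  (w : msample nS nA n) : is_kernel P -> 0 <= sample_prob P w.
Proof. by move=> [P0 _]; apply: prodr_ge0. Qed.

Lemma sum_sample_prob (R : realType) nS nA n (P : mkernel R nS nA) :
  is_kernel P -> \sum_(w : msample nS nA n) sample_prob P w = 1.
Proof.
move=> [_ P1]; rewrite /sample_prob.
rewrite -(bigA_distr_bigA (fun (k : 'I_nS * 'I_nA * 'I_n) x => P k.1.1 k.1.2 x)).
by rewrite big1.
Qed.

Lemma sample_prob_set (R : realType) nS nA n (P : mkernel R nS nA)
    (w : msample nS nA n) k x :
  sample_prob P w * P k.1.1 k.1.2 x
    = sample_prob P (sample_set w k x) * P k.1.1 k.1.2 (w k).
Proof.
rewrite /sample_prob (bigD1 k) //= [in RHS](bigD1 k) //= ffunE eqxx.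
rewrite mulrAC [in RHS]mulrAC [_ * P _ _ (w k)]mulrC; congr (_ * _).
by apply: eq_bigr => j jk; rewrite ffunE (negbTE jk).
Qed.

(* (w, x) |-> (w with w k replaced by x, w k) is an involution preserving the
   weight of the pair. *)
Lemma sexpect_resample (R : realType) nS nA n (P : mkernel R nS nA) k
    (G : msample nS nA n -> R) : is_kernel P ->
  sexpect P G
    = sexpect P (fun w => expect (P k.1.1 k.1.2) (fun x => G (sample_set w k x))).
Proof.
move=> [_ P1]; pose f (q : msample nS nA n * 'I_nS) := (sample_set q.1 k q.2, q.1 k).
have fK : involutive f.
  move=> [w x]; rewrite /f /=; congr (_, _); last by rewrite ffunE eqxx.
  by apply/ffunP => j; rewrite !ffunE; case: eqP => // ->.
transitivity (\sum_(q : msample nS nA n * 'I_nS)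
    sample_prob P q.1 * P k.1.1 k.1.2 q.2 * G q.1).
  rewrite -(pair_big xpredT xpredT
    (fun w x => sample_prob P w * P k.1.1 k.1.2 x * G w)) /=.
  apply: eq_bigr => w _; under eq_bigr do rewrite mulrAC.
  by rewrite -mulr_sumr P1 mulr1.
rewrite (reindex_inj (inv_inj fK)) /=.
rewrite -(pair_big xpredT xpredT (fun w x =>
   sample_prob P (sample_set w k x) * P k.1.1 k.1.2 (w k) * G (sample_set w k x))) /=.
apply: eq_bigr => w _; rewrite mulr_sumr; apply: eq_bigr => x _.
by rewrite -sample_prob_set mulrA.
Qed.

Lemma sexpect_mono (R : realType) nS nA n (P : mkernel R nS nA)
    (G H : msample nS nA n -> R) :
  is_kernel P -> (forall w, G w <= H w) -> sexpect P G <= sexpect P H.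
Proof.
by move=> Pk GH; apply: ler_sum => w _; rewrite ler_wpM2l ?sample_prob_ge0.
Qed.

(** Samples are integrated out one at a time: redrawing sample [i] at [(s, a)] changes neither [g]
    nor the other factors. [g] may still depend on the samples at all other pairs, as a
    data-dependent test function must. *)
Lemma sexpect_prod_le1 (R : realType) nS nA n (P : mkernel R nS nA) s a
    (g : msample nS nA n -> 'I_nS -> R) : is_kernel P ->
  (forall w i x, g (sample_set w (s, a, i) x) = g w) ->
  (forall w x, 0 <= g w x) -> (forall w, expect (P s a) (g w) <= 1) ->
  sexpect P (fun w => \prod_(i < n) g w (w (s, a, i))) <= 1.
Proof.
move=> Pk gset g0 g1.
have H (r : seq 'I_n) : uniq r ->
    sexpect P (fun w => \prod_(i <- r) g w (w (s, a, i))) <= 1.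
  elim: r => [_|i r IH /= /andP[ir ur]].
    rewrite /sexpect; under eq_bigr do rewrite big_nil mulr1.
    by rewrite sum_sample_prob.
  apply: le_trans (IH ur); rewrite (sexpect_resample (s, a, i)) //.
  apply: sexpect_mono => // w /=.
  have -> : expect (P s a) (fun x => \prod_(j <- i :: r)
      g (sample_set w (s, a, i) x) (sample_set w (s, a, i) x (s, a, j)))
    = (\prod_(j <- r) g w (w (s, a, j))) * expect (P s a) (g w).
    rewrite -expectZ; apply: eq_expect => x.
    rewrite big_cons gset ffunE eqxx mulrC; congr (_ * _).
    apply: eq_big_seq => j jr; rewrite ffunE; case: eqP => // -[ji].
    by move: ir; rewrite -ji jr.
  by rewrite ler_piMr //; apply: prodr_ge0.
have := H (index_enum 'I_n) (index_enum_uniq _).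
by [].
Qed.

Lemma Phat_expect (R : realType) nS nA n (w : msample nS nA n) s a (f : 'I_nS -> R) :
  expect (Phat R w s a) f = n%:R^-1 * \sum_(i < n) f (w (s, a, i)).
Proof.
rewrite /expect /Phat; under eq_bigr do rewrite -mulrA.
rewrite -mulr_sumr; congr (_ * _).
rewrite (partition_big (fun i => w (s, a, i)) xpredT) //=.
apply: eq_bigr => x _; rewrite (eq_bigr (fun=> f x)) => [|i /eqP-> //].
rewrite sumr_const mulr_natl; congr (_ *+ _).
apply: eq_card => i; apply/idP/idP => [/set_mem//|h]; exact/mem_set.
Qed.

Lemma is_kernel_Phat (R : realType) nS nA n (w : msample nS nA n) :
  (0 < n)%N -> is_kernel (Phat R w).
Proof.
move=> n0; split=> [s a x|s a]; first by rewrite mulr_ge0 // ?invr_ge0 ler0n.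
have := Phat_expect w s a (fun=> 1 : R).
rewrite sumr_const card_ord mulVf ?pnatr_eq0 -?lt0n // => <-.
by apply: eq_bigr => x _; rewrite mulr1.
Qed.

Lemma Prob_ge (R : realType) nS nA n (P : mkernel R nS nA)
    (E : msample nS nA n -> Prop) (Z : msample nS nA n -> R) delta :
  is_kernel P -> (forall w, 0 <= Z w) -> (forall w, ~ E w -> 1 <= Z w) ->
  sexpect P Z <= delta -> 1 - delta <= Prob P E.
Proof.
move=> Pk Z0 Z1 Zd; rewrite lerBlDr -(sum_sample_prob n Pk).
apply: le_trans (lerD (lexx _) Zd).
rewrite /Prob /sexpect -big_split /=; apply: ler_sum => w _.
have p0 := sample_prob_ge0 w Pk.
case: asboolP => Ew; first by rewrite lerDl mulr_ge0.
by rewrite add0r ler_peMr // Z1.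
Qed.

Lemma expR_le_quad (R : realType) (x : R) : `|x| <= 2^-1 ->
  expR x <= 1 + x + 2 * x ^+ 2.
Proof.
rewrite ler_norml => /andP[x1 x2].
have h : (1 - x) * expR x <= 1.
  by rewrite -[leRHS](expRxMexpNx_1 x) mulrC ler_wpM2l ?expR_ge0 // expR_ge1Dx.
have h1 : 0 < 1 - x by lra.
rewrite -(ler_pM2l h1); apply: (le_trans h).
suff : 0 <= x ^+ 2 * (1 - 2 * x) by nra.
by rewrite mulr_ge0 ?sqr_ge0 //; lra.
Qed.

(** From [expR y <= 1 / (1 - y)], as [(1 - y) (1 + x) = 1 + x^2 (1 + 2 x)]. With the correction
    inside the exponent, products over samples produce an empirical second moment. *)
Lemma expR_sub_quad_le (R : realType) (x : R) : `|x| <= 2^-1 ->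
  expR (x - 2 * x ^+ 2) <= 1 + x.
Proof.
rewrite ler_norml => /andP[x1 x2]; set y := x - _.
have h : (1 - y) * expR y <= 1.
  by rewrite -[leRHS](expRxMexpNx_1 y) mulrC ler_wpM2l ?expR_ge0 // expR_ge1Dx.
have h1 : 0 < 1 - y by rewrite /y; nra.
rewrite -(ler_pM2l h1); apply: (le_trans h).
have : 0 <= x ^+ 2 * (1 + 2 * x).
  by rewrite mulr_ge0 ?sqr_ge0 //; lra.
rewrite /y; nra.
Qed.

Lemma expect_sub_sq (R : realType) n (p f : 'I_n -> R) c : \sum_x p x = 1 ->
  expect p (fun x => (f x - c) ^+ 2)
    = expect p (fun x => f x ^+ 2) - 2 * c * expect p f + c ^+ 2.
Proof.
move=> p1; rewrite -[c ^+ 2 in RHS](expect_const _ p1) -mulNr -expectZ -!expectD.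
by apply: eq_expect => x; ring.
Qed.

Lemma expect_sq_le (R : realType) n (p f : 'I_n -> R) :
  (forall x, 0 <= p x) -> \sum_x p x = 1 ->
  expect p f ^+ 2 <= expect p (fun x => f x ^+ 2).
Proof.
move=> p0 p1; have := @expect_ge0 _ _ p (fun x => (f x - expect p f) ^+ 2) p0.
by rewrite expect_sub_sq // => /(_ (fun x => sqr_ge0 _)); lra.
Qed.

Lemma expect_bounds (R : realType) n (p f : 'I_n -> R) lo hi :
  (forall x, 0 <= p x) -> \sum_x p x = 1 -> (forall x, lo <= f x <= hi) ->
  lo <= expect p f <= hi.
Proof.
move=> p0 p1 fb; rewrite -{1}(expect_const lo p1) -[X in _ && (_ <= X)](expect_const hi p1).
by apply/andP; split; apply: expect_mono => // x; have /andP[] := fb x.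
Qed.

Lemma expect_dist (R : realType) n (p f : 'I_n -> R) b x :
  (forall x, 0 <= p x) -> \sum_x p x = 1 -> (forall x y, f x - f y <= b) ->
  `|f x - expect p f| <= b.
Proof.
move=> p0 p1 fb; rewrite ler_norml; apply/andP; split.
  have : expect p f <= expect p (fun=> f x + b).
    by apply: expect_mono => // y; have := fb y x; lra.
  by rewrite expect_const //; lra.
have : expect p (fun=> f x - b) <= expect p f.
  by apply: expect_mono => // y; have := fb x y; lra.
by rewrite expect_const //; lra.
Qed.

Definition exp_sample_sum (R : realType) nS nA n s a
    (phi : msample nS nA n -> 'I_nS -> R) w : R :=
  expR (n%:R * expect (Phat R w s a) (phi w)).

Lemma sexpect_chernoff (R : realType) nS nA n (P : mkernel R nS nA) s a
    (phi : msample nS nA n -> 'I_nS -> R) : is_kernel P -> (0 < n)%N ->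
  (forall w i x, phi (sample_set w (s, a, i) x) = phi w) ->
  (forall w, expect (P s a) (fun x => expR (phi w x)) <= 1) ->
  sexpect P (exp_sample_sum s a phi) <= 1.
Proof.
move=> Pk n0 phiset phi1.
have -> : exp_sample_sum s a phi = fun w => \prod_(i < n) expR (phi w (w (s, a, i))).
  apply/funext => w; rewrite /exp_sample_sum Phat_expect mulVKf ?pnatr_eq0 -?lt0n //.
  by rewrite expR_sum.
apply: (@sexpect_prod_le1 _ _ _ _ _ _ _ (fun w x => expR (phi w x))) => // w i x.
by rewrite phiset.
Qed.

(** Bernstein form: centring kills the linear term of [expR_le_quad], and the variance under [p]
    compensates the quadratic one. It serves the plug-in policy, where the variance is needed under
    the true kernel. *)
Lemma expect_expR_var (R : realType) n (p f : 'I_n -> R) (l : R) :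
  (forall x, 0 <= p x) -> \sum_x p x = 1 -> 0 <= l ->
  (forall x y, l * (f x - f y) <= 2^-1) ->
  expect p (fun x => expR (l * (f x - expect p f)
    - 2 * l ^+ 2 * expect p (fun x => (f x - expect p f) ^+ 2))) <= 1.
Proof.
move=> p0 p1 l0 lf; set m := expect p f; set v := expect p (fun x => (f x - m) ^+ 2).
have lfm x : `|l * (f x - m)| <= 2^-1.
  have := @expect_dist _ _ p (fun x => l * f x) 2^-1 x p0 p1.
  by rewrite expectZ -mulrBr; apply=> y z; rewrite -mulrBr.
have step : expect p (fun x => expR (l * (f x - m))) <= expR (2 * l ^+ 2 * v).
  apply: le_trans (expR_ge1Dx _).
  apply: (@le_trans _ _ (expect p (fun x =>
      1 + ((- (l * m) + l * f x) + 2 * l ^+ 2 * (f x - m) ^+ 2)))).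
    apply: expect_mono => // x; apply: le_trans (expR_le_quad (lfm x)) _.
    by rewrite le_eqVlt; apply/orP; left; apply/eqP; ring.
  by rewrite !expectD !expectZ !expect_const // -/m -/v; lra.
have -> : expect p (fun x => expR (l * (f x - m) - 2 * l ^+ 2 * v))
    = expR (- (2 * l ^+ 2 * v)) * expect p (fun x => expR (l * (f x - m))).
  by rewrite -expectZ; apply: eq_expect => x; rewrite -expRD addrC.
by rewrite -[leRHS](expRxMexpNx_1 (2 * l ^+ 2 * v)) mulrC ler_wpM2r // expR_ge0.
Qed.

(** Pointwise, [expR_sub_quad_le] gives a bound affine in [f] with mean 1. Since the penalty is
    evaluated at the sample, the sum over samples is a second moment under [Phat] about the true
    mean, as needed for the stationary law of [Phat]. *)
Lemma expect_expR_selfnorm (R : realType) n (p f : 'I_n -> R) (l : R) :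
  (forall x, 0 <= p x) -> \sum_x p x = 1 -> 0 <= l ->
  (forall x y, l * (f x - f y) <= 2^-1) ->
  expect p (fun x => expR (l * (expect p f - f x)
    - 2 * (l * (expect p f - f x)) ^+ 2)) <= 1.
Proof.
move=> p0 p1 l0 lf; set m := expect p f.
have lfm x : `|l * (m - f x)| <= 2^-1.
  have := @expect_dist _ _ p (fun x => l * f x) 2^-1 x p0 p1.
  by rewrite expectZ distrC -mulrBr; apply=> y z; rewrite -mulrBr.
apply: (@le_trans _ _ (expect p (fun x => 1 + (l * m + (- l) * f x)))).
  apply: expect_mono => // x; apply: le_trans (expR_sub_quad_le (lfm x)) _.
  by rewrite le_eqVlt; apply/orP; left; apply/eqP; ring.
by rewrite !expectD !expectZ !expect_const // -/m; lra.
Qed.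

Lemma chernoff_var_bound (R : realType) nS nA n (P : mkernel R nS nA) s a
    (f : msample nS nA n -> 'I_nS -> R) (l : msample nS nA n -> R) ell w :
  (0 < n)%N -> 0 < l w ->
  let m := expect (P s a) (f w) in
  let v := expect (P s a) (fun x => (f w x - m) ^+ 2) in
  exp_sample_sum s a (fun w x => l w * (f w x - expect (P s a) (f w))
    - 2 * l w ^+ 2 * expect (P s a) (fun x => (f w x - expect (P s a) (f w)) ^+ 2)) w
    <= expR ell ->
  expect (Phat R w s a) (f w) - m <= 2 * l w * v + ell / (l w * n%:R).
Proof.
move=> n0 l0 m v; have nR : 0 < n%:R :> R by rewrite ltr0n.
have [_ P1] := is_kernel_Phat R w n0.
rewrite /exp_sample_sum ler_expR -/m -/v.
have -> : expect (Phat R w s a) (fun x => l w * (f w x - m) - 2 * l w ^+ 2 * v)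
    = l w * (expect (Phat R w s a) (f w) - m) - 2 * l w ^+ 2 * v.
  rewrite (@eq_expect _ _ _ _ (fun x => (- (l w * m) - 2 * l w ^+ 2 * v) + l w * f w x)).
    by rewrite expectD expectZ expect_const //; ring.
  by move=> x; ring.
move=> h; rewrite -lerBlDl ler_pdivlMr ?mulr_gt0 //.
by apply: le_trans h; rewrite le_eqVlt; apply/orP; left; apply/eqP; ring.
Qed.

Lemma chernoff_selfnorm_bound (R : realType) nS nA n (P : mkernel R nS nA) s a
    (f : 'I_nS -> R) (l : R) ell (w : msample nS nA n) :
  (0 < n)%N -> 0 < l ->
  let m := expect (P s a) f in
  exp_sample_sum s a (fun=> fun x => l * (expect (P s a) f - f x)
    - 2 * (l * (expect (P s a) f - f x)) ^+ 2) w <= expR ell ->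
  m - expect (Phat R w s a) f
    <= 2 * l * expect (Phat R w s a) (fun x => (f x - m) ^+ 2) + ell / (l * n%:R).
Proof.
move=> n0 l0 m; have nR : 0 < n%:R :> R by rewrite ltr0n.
have [_ P1] := is_kernel_Phat R w n0.
rewrite /exp_sample_sum ler_expR -/m; set v := expect _ (fun x => (_ - _) ^+ 2).
have -> : expect (Phat R w s a) (fun x => l * (m - f x) - 2 * (l * (m - f x)) ^+ 2)
    = l * (m - expect (Phat R w s a) f) - 2 * l ^+ 2 * v.
  rewrite (@eq_expect _ _ _ _ (fun x =>
      (l * m + (- l) * f x) + (- (2 * l ^+ 2)) * (f x - m) ^+ 2)).
    by rewrite !expectD !expectZ expect_const // -/v; ring.
  by move=> x; ring.
move=> h; rewrite -lerBlDl ler_pdivlMr ?mulr_gt0 //.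
by apply: le_trans h; rewrite le_eqVlt; apply/orP; left; apply/eqP; ring.
Qed.

(** * Comparing the gains of one policy under two kernels *)

(** The [mu]-average [V] of the second moments of [h] about the [Q']-means obeys
    [V <= 2 B (1 + a0) + 2 B lam V]: the test enters a second time because the centre is not the
    mean under [Q]. *)
Lemma gain_perturbation_pos (R : realType) nS nA (Q Q' : mkernel R nS nA) r pi
    rho (h : 'cV[R]_nS) B a0 lam s0 :
  is_kernel Q -> is_kernel Q' -> is_policy pi ->
  (forall s a, 0 <= r s a <= 1) -> 0 <= rho ->
  (forall s, rpi r pi s 0 - rho = h s 0 - (Ppi Q' pi *m h) s 0) ->
  (forall s, 0 <= h s 0 <= B) -> 0 <= a0 -> 0 <= lam -> 2 * B * lam <= 2^-1 ->
  (forall s a, expect (Q' s a) (h^~ 0) - expect (Q s a) (h^~ 0)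
     <= a0 + lam * expect (Q s a) (fun x => (h x 0 - expect (Q' s a) (h^~ 0)) ^+ 2)) ->
  rho - gain Q r pi s0 0 <= a0 + 4 * B * lam * (1 + a0).
Proof.
move=> Qk Q'k pk r01 rho0 poi hB a00 lam0 Blam test.
have [Q0 Q1] := Qk; have [Q'0 Q'1] := Q'k; have [pi0 pi1] := pk.
pose mu := Pinf Q pi s0.
have [mu0 mu1] : (forall s, 0 <= mu s) /\ \sum_s mu s = 1.
  by have [Pi0 Pi1] := stochastic_Pinf Qk pk; split=> [s|]; [exact: Pi0|exact: Pi1].
have B0 : 0 <= B by have /andP[h0 h1] := hB s0; exact: le_trans h1.
pose m s a := expect (Q' s a) (h^~ 0).
pose D s a := m s a - expect (Q s a) (h^~ 0).
pose W s a := expect (Q s a) (fun x => (h x 0 - m s a) ^+ 2).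
have W0 s a : 0 <= W s a by apply: expect_ge0 => // x; exact: sqr_ge0.
pose h2 : 'cV[R]_nS := \col_s h s 0 ^+ 2.
have stat (v : 'cV[R]_nS) : expect mu (fun s => (Ppi Q pi *m v) s 0) = expect mu (v^~ 0).
  have /matrixP/(_ s0 0) := congr1 (fun A => A *m v) (Pinf_mulr Qk pk).
  by rewrite -mulmxA [LHS]mxE [RHS]mxE.
have rE s : rpi r pi s 0 = rho + (h s 0 - (Ppi Q' pi *m h) s 0) by rewrite -poi; ring.
have gapE : rho - gain Q r pi s0 0 = expect mu (fun s => expect (pi s) (D s)).
  have -> : gain Q r pi s0 0 = expect mu (fun s => rpi r pi s 0) by rewrite /gain mxE.
  have -> : expect mu (fun s => expect (pi s) (D s))
      = expect mu (fun s => (rho + h s 0 + (-1) * rpi r pi s 0) + (-1) * (Ppi Q pi *m h) s 0).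
    apply: eq_expect => s; rewrite rE !Ppi_mulE.
    rewrite (@eq_expect _ _ _ _ (fun a => m s a + (-1) * expect (Q s a) (h^~ 0))).
      by rewrite expectD expectZ /expect; ring.
    by move=> a; rewrite /D; ring.
  by rewrite !expectD !expectZ expect_const // stat; ring.
pose T s := expect (pi s) (W s); pose V := expect mu T.
have Dle s a : D s a <= a0 + lam * W s a by exact: test.
have gapV : expect mu (fun s => expect (pi s) (D s)) <= a0 + lam * V.
  apply: (@le_trans _ _ (expect mu (fun s => a0 + lam * T s))).
    apply: expect_mono => // s.
    apply: (@le_trans _ _ (expect (pi s) (fun a => a0 + lam * W s a))).
      by apply: expect_mono => // a; exact: Dle.
    by rewrite expectD expectZ expect_const.
  by rewrite expectD expectZ expect_const.
have m_bd s a : 0 <= m s a <= B by apply: expect_bounds.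
have M'h_bd s : 0 <= (Ppi Q' pi *m h) s 0 <= B.
  by rewrite Ppi_mulE -/(expect (pi s) (m s)) expect_bounds.
(* Since the [Q]-mean of [h] is [m - D], the second moment about [m] is the [Q]-mean of [h^2] minus
   [m^2] plus [2 m D]. The test bounds [m D], and Jensen over the actions replaces the mean of [m^2]
   by the square of the mean. *)
have TE s : T s <= (Ppi Q pi *m h2) s 0
    + ((-1) * (Ppi Q' pi *m h) s 0 ^+ 2 + (2 * B * a0 + 2 * B * lam * T s)).
  apply: (@le_trans _ _ (expect (pi s) (fun a => expect (Q s a) (h2^~ 0)
     + ((-1) * m s a ^+ 2 + (2 * B * a0 + 2 * B * lam * W s a))))).
    apply: expect_mono => // a; rewrite {1}/W expect_sub_sq //.
    rewrite (@eq_expect _ _ _ (fun x => h x 0 ^+ 2) (h2^~ 0)); last first.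
      by move=> x; rewrite /h2 mxE.
    have -> : expect (Q s a) (h^~ 0) = m s a - D s a by rewrite /D; ring.
    have /andP[ms0 msB] := m_bd s a.
    have : m s a * D s a <= B * (a0 + lam * W s a).
      apply: (@le_trans _ _ (m s a * (a0 + lam * W s a))).
        by rewrite ler_wpM2l.
      by rewrite ler_wpM2r // addr_ge0 // mulr_ge0.
    by lra.
  rewrite !expectD !expectZ expect_const //.
  rewrite -/(T s) -[expect (pi s) (fun a => expect (Q s a) (h2^~ 0))]Ppi_mulE.
  have := expect_sq_le (m s) (pi0 s) (pi1 s).
  have -> : expect (pi s) (m s) = (Ppi Q' pi *m h) s 0 by rewrite Ppi_mulE.
  by lra.
(* Stationarity will turn the average of the [Q]-means of [h^2] into that of [h^2]; what remains
   factors through the Poisson equation. *)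
have sq s : h s 0 ^+ 2 - (Ppi Q' pi *m h) s 0 ^+ 2 <= 2 * B.
  rewrite subr_sqr -poi.
  have /andP[h0 h1] := hB s; have /andP[k0 k1] := M'h_bd s.
  have /andP[_ r1] := rpi_bounds s r01 pk.
  apply: (@le_trans _ _ (1 * (h s 0 + (Ppi Q' pi *m h) s 0))).
    by rewrite ler_wpM2r ?addr_ge0 //; lra.
  by rewrite mul1r; lra.
have V0 : 0 <= V by apply: expect_ge0 => // s; exact: expect_ge0.
have : V <= 2 * B * (1 + a0) + 2 * B * lam * V.
  apply: (@le_trans _ _ (expect mu (fun s => (Ppi Q pi *m h2) s 0
    + (- 1 * h2 s 0 + (2 * B * (1 + a0) + 2 * B * lam * T s))))).
    apply: expect_mono => // s; apply: le_trans (TE s) _.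
    by have := sq s; rewrite [h2 s 0]mxE; lra.
  by rewrite !expectD !expectZ expect_const // stat -/V; lra.
rewrite gapE => hV; apply: le_trans gapV _.
(* Absorption: at most half of [V] stands on the right. *)
have : 2 * B * lam * V <= 2^-1 * V by rewrite ler_wpM2r.
have hV4 : 2 * B * lam * V <= 2^-1 * V -> V <= 4 * B * (1 + a0) by lra.
move=> /hV4 {}hV4; rewrite lerD2l.
apply: le_trans (ler_wpM2l lam0 hV4) _.
by rewrite le_eqVlt; apply/orP; left; apply/eqP; ring.
Qed.

(** Poisson equation, test and span see [h] only up to an additive constant, so [h] may be shifted
    to have minimum 0; the product [(r - rho) (h + Q' h)] needs that sign. *)
Lemma gain_perturbation (R : realType) nS nA (Q Q' : mkernel R nS nA) r pi
    rho (h : 'cV[R]_nS) B a0 lam s0 :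
  is_kernel Q -> is_kernel Q' -> is_policy pi ->
  (forall s a, 0 <= r s a <= 1) -> 0 <= rho ->
  (forall s, rpi r pi s 0 - rho = h s 0 - (Ppi Q' pi *m h) s 0) ->
  (forall s s', h s 0 - h s' 0 <= B) -> 0 <= a0 -> 0 <= lam -> 2 * B * lam <= 2^-1 ->
  (forall s a, expect (Q' s a) (h^~ 0) - expect (Q s a) (h^~ 0)
     <= a0 + lam * expect (Q s a) (fun x => (h x 0 - expect (Q' s a) (h^~ 0)) ^+ 2)) ->
  rho - gain Q r pi s0 0 <= a0 + 4 * B * lam * (1 + a0).
Proof.
move=> Qk Q'k pk r01 rho0 poi hB a00 lam0 Blam test.
have [_ Q1] := Qk; have [_ Q'1] := Q'k.
have Mst := stochastic_Ppi Q'k pk.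
case: (@arg_maxP _ R 'I_nS s0 predT (fun x => - h x 0)) => // l _ lmin.
have hE s : (h + const_mx (- h l 0)) s 0 = h s 0 - h l 0 by rewrite add_mxE mxE.
have EE (p : 'I_nS -> R) : \sum_x p x = 1 ->
    expect p ((h + const_mx (- h l 0))^~ 0) = expect p (h^~ 0) - h l 0.
  move=> p1; rewrite -[X in _ = _ - X](expect_const _ p1).
  rewrite (@eq_expect _ _ _ _ (fun x => h x 0 + (-1) * h l 0)).
    by rewrite expectD !expect_const //; ring.
  by move=> x; rewrite hE; ring.
apply: (@gain_perturbation_pos _ _ _ Q Q' _ _ _ (h + const_mx (- h l 0))) => //.
- move=> s; rewrite mulmxDr stochastic_const // poi !add_mxE ![const_mx _ _ _]mxE; ring.
- move=> s; rewrite hE hB subr_ge0 andbT -lerN2; exact: lmin.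
- move=> s a; rewrite !EE //.
  rewrite (@eq_expect _ _ _ (fun x => ((h + const_mx (- h l 0)) x 0 -
      (expect (Q' s a) (h^~ 0) - h l 0)) ^+ 2)
    (fun x => (h x 0 - expect (Q' s a) (h^~ 0)) ^+ 2)).
    by have := test s a; lra.
  by move=> x; rewrite hE; congr (_ ^+ 2); ring.
Qed.

(** * Value iteration with one pinned Q-value, and the tuning of the tests *)

(* The base value [0] of the maximum is harmless because rewards and iterates are
   nonnegative. *)
Definition pinned_bellman (R : realType) nS nA (Ph : mkernel R nS nA) r (g : R)
    (k : 'I_nS * 'I_nA) (u : R) (V : 'I_nS -> R) : 'I_nS -> R :=
  fun s => \big[Order.max/0]_(a < nA)
    (if (s, a) == k then u else r s a + g * expect (Ph s a) V).

Lemma bigmax_le_add (R : realType) (n : nat) (F G : 'I_n -> R) c :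
  0 <= c -> (forall i, F i <= G i + c) ->
  \big[Order.max/0]_(i < n) F i <= \big[Order.max/0]_(i < n) G i + c.
Proof.
move=> c0 FG; apply: bigmax_le => [|i _].
  by rewrite addr_ge0 // bigmax_ge_id.
apply: le_trans (FG i) _; rewrite lerD2r; exact: (le_bigmax _ G).
Qed.

Lemma pinned_bellman_dist (R : realType) nS nA (Ph : mkernel R nS nA) r g k u u' c
    (V V' : 'I_nS -> R) :
  is_kernel Ph -> 0 <= g -> 0 <= c -> `|u - u'| <= c ->
  (forall s, g * `|V s - V' s| <= c) ->
  forall s, `|pinned_bellman Ph r g k u V s - pinned_bellman Ph r g k u' V' s| <= c.
Proof.
move=> [P0 P1] g0 c0; have one_side u1 u2 W1 W2 : `|u1 - u2| <= c ->
    (forall s, g * `|W1 s - W2 s| <= c) ->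
    forall s, pinned_bellman Ph r g k u1 W1 s <= pinned_bellman Ph r g k u2 W2 s + c.
  move=> uc Wc s; apply: bigmax_le_add => // a; case: eqP => _.
    by have := ler_norm (u1 - u2); lra.
  have : expect (Ph s a) (fun x => g * W1 x) <= expect (Ph s a) (fun x => g * W2 x + c).
    apply: expect_mono => // x; have := ler_norm (W1 x - W2 x).
    by move=> /(ler_wpM2l g0); have := Wc x; lra.
  by rewrite expectD !expectZ expect_const //; lra.
move=> uc Vc s; rewrite ler_norml; apply/andP; split.
  have := @one_side u' u V' V _ _ s; rewrite distrC => /(_ uc).
  by move=> h; rewrite lerNl opprB lerBlDl h // => x; rewrite distrC.
by have := @one_side u u' V V' uc Vc s; lra.
Qed.

(** Finitely many iterates stand in for the fixed point, so that independence from the samples at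
    [k] is a plain induction. *)
Definition pinned_value (R : realType) nS nA (Ph : mkernel R nS nA) r g k u N :=
  iter N (pinned_bellman Ph r g k u) (fun=> 0).

(** When the pin is the Q-value of [V] at [k], both branches agree and the operator is the usual
    Bellman operator; [d] provides an action attaining the maximum. *)
Lemma pinned_bellman_fixed (R : realType) nS nA (Ph : mkernel R nS nA) r g
    (d : det_policy nS nA) k (V : 'I_nS -> R) :
  (forall s, 0 <= V s) ->
  (forall s a, r s a + g * expect (Ph s a) V <= V s) ->
  (forall s, V s = r s (d s) + g * expect (Ph s (d s)) V) ->
  forall s, pinned_bellman Ph r g k (r k.1 k.2 + g * expect (Ph k.1 k.2) V) V s = V s.
Proof.
move=> V0 Vle Vd s.
have qE a : (if (s, a) == k then r k.1 k.2 + g * expect (Ph k.1 k.2) V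
    else r s a + g * expect (Ph s a) V) = r s a + g * expect (Ph s a) V.
  by case: eqP => [<-|].
apply/eqP; rewrite eq_le; apply/andP; split.
  by apply: bigmax_le => // a _; rewrite qE.
rewrite {1}Vd -qE; exact: (le_bigmax _ (fun a => if (s, a) == k
  then r k.1 k.2 + g * expect (Ph k.1 k.2) V else r s a + g * expect (Ph s a) V)).
Qed.

(** One step turns an error [e] into at most [max (c, g e)], so the pin error does not accumulate to
    [c / (1 - g)]; the initial error, at most [1 / (1 - g)], decays geometrically. *)
Lemma pinned_value_close (R : realType) nS nA (Ph : mkernel R nS nA) r g
    (d : det_policy nS nA) k (V : 'I_nS -> R) u c N :
  is_kernel Ph -> 0 <= g < 1 ->
  (forall s, 0 <= V s <= (1 - g)^-1) ->
  (forall s a, r s a + g * expect (Ph s a) V <= V s) ->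
  (forall s, V s = r s (d s) + g * expect (Ph s (d s)) V) ->
  0 <= c -> `|u - (r k.1 k.2 + g * expect (Ph k.1 k.2) V)| <= c ->
  forall s, `|pinned_value Ph r g k u N s - V s| <= c + g ^+ N / (1 - g).
Proof.
move=> Pk /andP[g0 g1] Vb Vle Vd c0 uc; have g1' : 0 < (1 - g)^-1.
  by rewrite invr_gt0 subr_gt0.
elim: N => [|N IH] s.
  have /andP[V0 V1] := Vb s.
  by rewrite /= sub0r normrN ger0_norm // expr0 mul1r; lra.
have gN : 0 <= g ^+ N.+1 / (1 - g) by rewrite mulr_ge0 ?exprn_ge0 // ltW.
rewrite -(pinned_bellman_fixed k _ Vle Vd); last by move=> x; have /andP[] := Vb x.
apply: pinned_bellman_dist => //; first exact: addr_ge0.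
  by apply: le_trans uc _; rewrite lerDl.
move=> x; apply: le_trans (ler_wpM2l g0 (IH x)) _.
by rewrite mulrDr mulrA -exprS lerD2r ler_piMl // ltW.
Qed.

(** Row [(s, a)] of the kernel would be read only at the pair where the pin overrides it. *)
Lemma pinned_value_off (R : realType) nS nA n (r : 'I_nS -> 'I_nA -> R) g s a u N
    (w : msample nS nA n) i x :
  pinned_value (Phat R (sample_set w (s, a, i) x)) r g (s, a) u N
    = pinned_value (Phat R w) r g (s, a) u N.
Proof.
elim: N => //= N IH; rewrite /pinned_value /= in IH *; rewrite IH.
apply/funext => y; apply: eq_bigr => b _; case: eqP => // yb.
congr (_ + _ * _); apply: eq_bigr => z _; congr (_ * _).
rewrite /Phat; congr (_ * (card (mem (mkset _)))%:R).
apply/funext => j; rewrite ffunE ifF //; apply/eqP => -[ys ba _].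
by case: yb; rewrite ys ba.
Qed.

(* The square root minimises the order of l b + ell / (l n), the deviation for
   variances at most b; the cap keeps exponents in the range [-1/2, 1/2]. *)
Definition tuned_rate (R : realType) (ell : R) (n : nat) (b : R) : R :=
  Num.min (Num.sqrt (ell / (n%:R * b))) ((2 * b)^-1).

Lemma tuned_rate_gt0 (R : realType) (ell : R) n b :
  0 < ell -> (0 < n)%N -> 0 < b -> 0 < tuned_rate ell n b.
Proof.
move=> l0 n0 b0; rewrite lt_min sqrtr_gt0 divr_gt0 ?mulr_gt0 ?ltr0n //=.
by rewrite invr_gt0 mulr_gt0.
Qed.

Lemma tuned_rate_le (R : realType) (ell : R) n b : 0 < b ->
  tuned_rate ell n b * b <= 2^-1.
Proof.
move=> b0; rewrite -ler_pdivlMr // -invfM.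
by rewrite ge_min lexx orbT.
Qed.

(** In this range the cap is inactive, and the two terms of the deviation bound balance. *)
Lemma tuned_rateE (R : realType) (ell : R) n b :
  0 < ell -> (0 < n)%N -> 0 < b -> Num.sqrt (ell * b / n%:R) <= 2^-1 ->
  tuned_rate ell n b = Num.sqrt (ell * b / n%:R) / b /\
  ell / (tuned_rate ell n b * n%:R) = Num.sqrt (ell * b / n%:R).
Proof.
move=> l0 n0 b0 h; have nR : 0 < n%:R :> R by rewrite ltr0n.
have x0 : 0 < ell / (n%:R * b) by rewrite divr_gt0 // mulr_gt0.
have e : Num.sqrt (ell / (n%:R * b)) = Num.sqrt (ell * b / n%:R) / b.
  have -> : ell * b / n%:R = ell / (n%:R * b) * b ^+ 2.
    by field; rewrite !gt_eqF.
  by rewrite (sqrtrM (b ^+ 2) (ltW x0)) sqrtr_sqr gtr0_norm // mulfK // gt_eqF.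
have t : tuned_rate ell n b = Num.sqrt (ell * b / n%:R) / b.
  rewrite /tuned_rate e; apply/min_idPl.
  by rewrite invfM ler_pM2r // invr_gt0.
split=> //; rewrite t; set q := Num.sqrt _ in h t *.
have q2 : q ^+ 2 = ell * b / n%:R.
  by rewrite sqr_sqrtr // divr_ge0 ?mulr_ge0 // ltW.
have q0 : 0 < q by rewrite sqrtr_gt0 divr_gt0 // mulr_gt0.
have -> : ell = q ^+ 2 * n%:R / b by rewrite q2; field; rewrite !gt_eqF.
by field; rewrite !gt_eqF.
Qed.

(** * From tests to the two outer gain differences *)

Lemma expect_var_le (R : realType) n (p f : 'I_n -> R) c : \sum_x p x = 1 ->
  expect p (fun x => (f x - expect p f) ^+ 2) <= expect p (fun x => (f x - c) ^+ 2).
Proof.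
move=> p1; rewrite !expect_sub_sq //; have := sqr_ge0 (expect p f - c).
by move: (expect p f) => m; nra.
Qed.

(** The test holds for a proxy [f], with a rate tuned to the span of [f] so as to stay independent
    of the samples at the pair, but is wanted for [h]. Closeness up to a constant makes the two
    rates comparable. *)
Lemma approx_test (R : realType) nS n (p q : 'I_nS -> R) (f h : 'cV[R]_nS) c ell :
  (forall x, 0 <= p x) -> \sum_x p x = 1 ->
  (forall x, 0 <= q x) -> \sum_x q x = 1 -> (0 < n)%N -> 1 <= ell ->
  (forall x, `|f x 0 - h x 0 - c| <= 3 / n%:R) ->
  let eps := Num.sqrt (ell * (spnorm h + 7) / n%:R) in
  let lam := tuned_rate ell n (spnorm f + 1) in
  eps <= 64^-1 ->
  expect q (f^~ 0) - expect p (f^~ 0)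
    <= 2 * lam * expect p (fun x => (f x 0 - expect p (f^~ 0)) ^+ 2) + ell / (lam * n%:R) ->
  expect q (h^~ 0) - expect p (h^~ 0)
    <= 43 * eps
     + 16 * (eps / (spnorm h + 7)) * expect p (fun x => (h x 0 - expect q (h^~ 0)) ^+ 2).
Proof.
move=> p0 p1 q0 q1 n0 ell1 fh eps lam epsle test.
have nR : 0 < n%:R :> R by rewrite ltr0n.
have n1 : 1 <= n%:R :> R by rewrite ler1n.
have ell0 : 0 < ell by lra.
have ninv1 : n%:R^-1 <= 1 :> R by rewrite invf_le1.
have ninv0 : 0 < n%:R^-1 :> R by rewrite invr_gt0.
have s0 : 'I_nS.
  by case: (nS) p p1 {p0 test q q0 q1 f h fh eps epsle lam} => [|m] p p1;
    [move: p1; rewrite big_ord0 => /eqP; rewrite eq_sym oner_eq0 | exact: ord0].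
have fh1 x y : f x 0 - f y 0 <= spnorm h + 6 * n%:R^-1.
  have := fh x; have := fh y; rewrite !ler_norml => /andP[? ?] /andP[? ?].
  have := spnorm_ge h x y; lra.
have hf1 x y : h x 0 - h y 0 <= spnorm f + 6 * n%:R^-1.
  have := fh x; have := fh y; rewrite !ler_norml => /andP[? ?] /andP[? ?].
  have := spnorm_ge f x y; lra.
have spf := spnorm_le s0 fh1; have sph := spnorm_le s0 hf1.
have f0 : 0 <= spnorm f by have := spnorm_ge f s0 s0; rewrite subrr.
have h0 : 0 <= spnorm h by have := spnorm_ge h s0 s0; rewrite subrr.
set b := spnorm f + 1 in lam test *; set B := spnorm h + 7 in eps epsle *.
have b1 : 1 <= b by rewrite /b; lra.
(* The spans differ by at most [6 / n <= 6]: hence the offset 7 = 6 + 1, and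
   [B <= spnorm f + 13 <= 16 * b]. *)
have bB : b <= B by rewrite /b /B; lra.
have Bb : B <= 16 * b by rewrite /b /B; lra.
have b0 : 0 < b by lra.
have B0 : 0 < B by lra.
pose e := Num.sqrt (ell * b / n%:R).
have e_eps : e <= eps.
  by apply: ler_wsqrtr; rewrite ler_pM2r // ler_pM2l.
have [lamE ellE] : lam = e / b /\ ell / (lam * n%:R) = e.
  by apply: tuned_rateE => //; apply: le_trans e_eps _; lra.
have e0 : 0 <= e by exact: sqrtr_ge0.
have eps0 : 0 <= eps by exact: sqrtr_ge0.
have e2 : e ^+ 2 = ell * b / n%:R.
  by rewrite sqr_sqrtr // divr_ge0 ?mulr_ge0 // ltW.
have eps2 : eps ^+ 2 = ell * B / n%:R.
  by rewrite sqr_sqrtr // divr_ge0 ?mulr_ge0 // ltW.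
have lam4 : lam <= 4 * (eps / B).
  rewrite lamE -ler_sqr ?nnegrE; last 2 first.
  - by rewrite divr_ge0 // ltW.
  - by rewrite mulr_ge0 // divr_ge0 // ltW.
  rewrite exprMn [leRHS]exprMn [(eps / B) ^+ 2]exprMn e2 eps2.
  have -> : ell * b / n%:R * b^-1 ^+ 2 = ell / n%:R / b by field; rewrite !gt_eqF.
  have -> : 4 ^+ 2 * (ell * B / n%:R * B^-1 ^+ 2) = ell / n%:R * (16 / B).
    by field; rewrite !gt_eqF.
  rewrite ler_pM2l ?divr_gt0 // ler_pdivlMr // mulrC ler_pdivrMr //; lra.
have lam0 : 0 <= lam by rewrite lamE divr_ge0 // ltW.
have lam_eps : lam <= eps.
  by apply: le_trans e_eps; rewrite lamE ler_pdivrMr // ler_peMr.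
have n_eps : n%:R^-1 <= eps.
  rewrite -ler_sqr ?nnegrE ?(ltW ninv0) // eps2 expr2.
  apply: ler_wpM2r; first exact: ltW.
  apply: (le_trans ninv1); rewrite -[1]mulr1; apply: ler_pM => //; lra.
set W := expect p (fun x => (h x 0 - _) ^+ 2).
have W0 : 0 <= W by apply: expect_ge0 => // x; exact: sqr_ge0.
(* Recentring at another point only increases the second moment; then [(z + y)^2 <= 2 z^2 + 2 y^2]
   with [|y| <= 3 / n] gives 18. *)
have var_le : expect p (fun x => (f x 0 - expect p (f^~ 0)) ^+ 2)
    <= 2 * W + 18 * n%:R^-1 ^+ 2.
  apply: le_trans (expect_var_le (f^~ 0) (expect q (h^~ 0) + c) p1) _.
  rewrite -(expect_const (18 * _) p1) -expectZ -expectD.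
  apply: expect_mono => // x; have := fh x.
  have -> : f x 0 - (expect q (h^~ 0) + c)
    = (h x 0 - expect q (h^~ 0)) + (f x 0 - h x 0 - c) by ring.
  move: (f x 0 - h x 0 - c) (h x 0 - _) => y z.
  rewrite ler_norml => /andP[y1 y2].
  have : 0 <= (3 / n%:R - y) * (3 / n%:R + y) by rewrite mulr_ge0 //; lra.
  have := sqr_ge0 (z - y); lra.
have qf : expect q (h^~ 0) + c - 3 / n%:R <= expect q (f^~ 0).
  rewrite -addrA -(expect_const (c - _) q1) -expectD.
  apply: expect_mono => // x; have := fh x; rewrite ler_norml => /andP[]; lra.
have pf : expect p (f^~ 0) <= expect p (h^~ 0) + (c + 3 / n%:R).
  rewrite -(expect_const (c + _) p1) -expectD.
  apply: expect_mono => // x; have := fh x; rewrite ler_norml => /andP[]; lra.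
rewrite ellE in test.
have t1 : 2 * lam * expect p (fun x => (f x 0 - expect p (f^~ 0)) ^+ 2)
    <= 2 * lam * (2 * W + 18 * n%:R^-1 ^+ 2).
  by rewrite ler_wpM2l // mulr_ge0.
have t2 : lam * W <= 4 * (eps / B) * W by rewrite ler_wpM2r.
have t3 : lam * n%:R^-1 ^+ 2 <= eps.
  apply: le_trans lam_eps; rewrite ler_piMr //.
  by rewrite expr_le1 // ltW.
(* 43 = 1 + 6 + 36: the term [e], two shifts by [3 / n], and [2 * 18] times [lam / n^2]. *)
lra.
Qed.

Lemma star_gap (R : realType) nS nA n (P Ph : mkernel R nS nA) r d ell s0 :
  is_kernel P -> is_kernel Ph -> (forall s a, 0 <= r s a <= 1) -> (0 < n)%N ->
  1 <= ell -> weakly_communicating P -> blackwell_optimal P r d ->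
  let h := bias P r (of_det d) in
  let eps := Num.sqrt (ell * (spnorm h + 7) / n%:R) in
  let lam := tuned_rate ell n (spnorm h + 7) in
  eps <= 64^-1 ->
  (forall s a, expect (P s a) (h^~ 0) - expect (Ph s a) (h^~ 0)
    <= 2 * lam * expect (Ph s a) (fun x => (h x 0 - expect (P s a) (h^~ 0)) ^+ 2)
       + ell / (lam * n%:R)) ->
  gain P r (of_det d) s0 0 - gain Ph r (of_det d) s0 0 <= 20 * eps.
Proof.
move=> Pk Phk r01 n0 ell1 wc bo h eps lam epsle test.
have pk := is_policy_of_det R d.
have h0 : 0 <= spnorm h by have := spnorm_ge h s0 s0; rewrite subrr.
set B := spnorm h + 7 in eps lam epsle test *.
have B0 : 0 < B by rewrite /B; lra.
have ell0 : 0 < ell by lra.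
have [lamE ellE] : lam = eps / B /\ ell / (lam * n%:R) = eps.
  by apply: tuned_rateE => //; apply: le_trans epsle _; lra.
have eps0 : 0 <= eps by exact: sqrtr_ge0.
have Blam : B * lam = eps by rewrite lamE mulrCA divff ?mulr1 // gt_eqF.
have lam0 : 0 <= lam by rewrite lamE divr_ge0 // ltW.
apply: le_trans (gain_perturbation (Q := Ph) (Q' := P) (h := h) (B := B)
  (a0 := eps) (lam := 2 * lam) s0 Phk Pk pk r01 _ _ _ eps0 _ _ _) _.
- by have /andP[] := gain_bounds s0 Pk r01 pk.
- move=> s; rewrite {1}(poisson r Pk pk) add_mxE sub_mxE.
  by rewrite (wcomm_gain_constant s s0 Pk wc bo) /h; ring.
- by move=> s s'; have := spnorm_ge h s s'; rewrite /B; lra.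
- by rewrite mulr_ge0.
- have -> : 2 * B * (2 * lam) = 4 * (B * lam) by ring.
  by rewrite Blam; lra.
- by move=> s a; have := test s a; rewrite ellE; lra.
have -> : 4 * B * (2 * lam) * (1 + eps) = 8 * (B * lam) * (1 + eps) by ring.
rewrite Blam; have : eps * eps <= eps * 1 by rewrite ler_wpM2l //; lra.
lra.
Qed.

Lemma plugin_gap (R : realType) nS nA n (P Ph : mkernel R nS nA) r g N d pih ell s0 :
  is_kernel P -> is_kernel Ph -> (forall s a, 0 <= r s a <= 1) -> (0 < n)%N ->
  1 <= ell -> 0 <= g < 1 -> g ^+ N / (1 - g) <= n%:R^-1 ->
  weakly_communicating Ph -> blackwell_optimal Ph r d -> is_policy pih ->
  bias_optimal Ph r d pih ->
  let h := bias Ph r (of_det d) in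
  (exists c, forall s, `|Vstar Ph r g s 0 - h s 0 - c| <= n%:R^-1) ->
  let eps := Num.sqrt (ell * (spnorm h + 7) / n%:R) in
  eps <= 64^-1 ->
  (forall s a j, j%:R * (1 - g) <= n%:R ->
    let f : 'cV[R]_nS := \col_x pinned_value Ph r g (s, a) (j%:R / n%:R) N x in
    let lam := tuned_rate ell n (spnorm f + 1) in
    expect (Ph s a) (f^~ 0) - expect (P s a) (f^~ 0)
    <= 2 * lam * expect (P s a) (fun x => (f x 0 - expect (P s a) (f^~ 0)) ^+ 2)
       + ell / (lam * n%:R)) ->
  gain Ph r (of_det d) s0 0 - gain P r pih s0 0 <= 150 * eps.
Proof.
move=> Pk Phk r01 n0 ell1 g01 gN wc bo pk [gE bE] h [c hc] eps epsle test.
have dk := is_policy_of_det R d.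
have nR : 0 < n%:R :> R by rewrite ltr0n.
have h0 : 0 <= spnorm h by have := spnorm_ge h s0 s0; rewrite subrr.
have /andP[g0 g1] := g01; have i0 : 0 < 1 - g by rewrite subr_gt0.
have ninv0 : 0 < n%:R^-1 :> R by rewrite invr_gt0.
have [P0 P1] := Pk; have [Ph0 Ph1] := Phk.
have tst s a : expect (Ph s a) (h^~ 0) - expect (P s a) (h^~ 0)
  <= 43 * eps + 16 * (eps / (spnorm h + 7))
      * expect (P s a) (fun x => (h x 0 - expect (Ph s a) (h^~ 0)) ^+ 2).
  have [d' [VE bell]] := Vstar_optimal r d Phk g01.
  pose V := (Vstar Ph r g)^~ 0.
  have Vb x : 0 <= V x <= (1 - g)^-1.
    by rewrite /V VE; apply: Vpi_bounds => //; exact: is_policy_of_det.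
  have Vd x : V x = r x (d' x) + g * expect (Ph x (d' x)) V.
    rewrite /V {1}VE Vpi_eq //; last exact: is_policy_of_det.
    by rewrite rpi_of_detE Ppi_of_detE -VE.
  pose u := r s a + g * expect (Ph s a) V.
  have /andP[u0 u1] : 0 <= u <= (1 - g)^-1.
    have /andP[r0 _] := r01 s a; rewrite addr_ge0 ?mulr_ge0 ?expect_ge0 //=.
      by apply: le_trans (bell s a) _; have /andP[] := Vb s.
    by move=> x; have /andP[] := Vb x.
  (* The Q-value [u] depends on the samples, so its grid point is chosen only here; [test] covers
     the whole grid of [[0, 1 / (1 - g)]]. *)
  pose j := Num.truncn (u * n%:R).
  have un0 : 0 <= u * n%:R by rewrite mulr_ge0 // ltW.
  have /andP[j1 j2] := truncn_itv un0; rewrite -/j in j1 j2.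
  have jn : j%:R * (1 - g) <= n%:R.
    apply: le_trans (ler_wpM2r (ltW i0) j1) _.
    rewrite mulrAC ler_piMl ?(ltW nR) //.
    by rewrite -ler_pdivlMr // mul1r.
  have uj : `|j%:R / n%:R - u| <= n%:R^-1.
    have e : j%:R / n%:R - u = (j%:R - u * n%:R) / n%:R by field; rewrite gt_eqF.
    rewrite e normrM (gtr0_norm ninv0) ler_piMl ?(ltW ninv0) //.
    rewrite ler_norml; move: j2; rewrite -natr1 => j2.
    by apply/andP; split; lra.
  have close := @pinned_value_close R nS nA Ph r g d' (s, a) V (j%:R / n%:R)
    n%:R^-1 N Phk g01 Vb bell Vd (ltW ninv0) uj.
  (* Three errors of [1 / n]: [Vstar] against the bias, the rounded pin, the truncated iteration. *)
  apply: (@approx_test _ _ _ _ _ (\col_x pinned_value Ph r g (s, a) (j%:R / n%:R) N x) _ c) => //.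
    move=> x; have := close x; have := hc x; rewrite [(\col__ _) _ _]mxE -/(V x).
    rewrite !ler_norml => /andP[? ?] /andP[? ?]; apply/andP; split; lra.
  exact: test.
set B := spnorm h + 7 in eps epsle tst *.
have B0 : 0 < B by rewrite /B; lra.
have eps0 : 0 <= eps by exact: sqrtr_ge0.
have Blam : B * (eps / B) = eps by rewrite mulrCA divff ?mulr1 // gt_eqF.
have lam0 : 0 <= eps / B by rewrite divr_ge0 // ltW.
apply: le_trans (gain_perturbation (Q := P) (Q' := Ph) (h := h) (B := B)
  (a0 := 43 * eps) (lam := 16 * (eps / B)) s0 Pk Phk pk r01 _ _ _ _ _ _ tst) _.
- by have /andP[] := gain_bounds s0 Phk r01 dk.
(* [pih] may differ from the Blackwell policy, but equal gain and bias give it a Poisson equation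
   with the same [rho] and [h]. *)
- move=> s; rewrite {1}(poisson r Phk pk) gE bE -/h add_mxE sub_mxE.
  by rewrite (wcomm_gain_constant s s0 Phk wc bo); ring.
- by move=> s s'; have := spnorm_ge h s s'; rewrite /B; lra.
- by rewrite mulr_ge0.
- by rewrite mulr_ge0.
(* Origin of the threshold 1/64: absorption needs [32 * eps <= 1/2]. *)
- have -> : 2 * B * (16 * (eps / B)) = 32 * (B * (eps / B)) by ring.
  by rewrite Blam; lra.
have -> : 4 * B * (16 * (eps / B)) * (1 + 43 * eps)
  = 64 * (B * (eps / B)) * (1 + 43 * eps) by ring.
(* 150 = 43 + 64 + 43, the last from [64 * 43 * eps^2] with [eps <= 1/64]. *)
rewrite Blam; have : eps * eps <= eps * 64^-1 by rewrite ler_wpM2l.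
lra.
Qed.

(** * Confidence levels, union bound and assembly *)

(** For [x = 1 - ghat], the least admissible [k] gives a discount strictly above [ghat], and
    minimality keeps the grid size within a factor 2 of [n / x]. *)
Lemma ex_dyadic (R : realType) (x : R) : 0 < x <= 1 ->
  exists k, 2^-1 ^+ k.+1 < x /\ (2 : R) ^+ k.+1 <= 2 / x.
Proof.
move=> /andP[x0 x1].
have exk : exists k, 2^-1 ^+ k.+1 < x.
  exists (Num.truncn x^-1); rewrite exprVn invf_plt ?posrE ?exprn_gt0 //.
  apply: lt_trans (truncnS_gt _) _.
  by rewrite -natrX ltr_nat; exact: ltn_expl.
case: (ex_minnP exk) => k kx kmin; exists k; split=> //.
rewrite exprS ler_pM2l // -[leRHS]invrK -[x^-1^-1]/(x^-1^-1).
case: k kx kmin => [|k] kx kmin; first by rewrite expr0 invrK invf_ge1.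
rewrite invrK -[leLHS]invrK lef_pV2 ?posrE ?invr_gt0 ?exprn_gt0 //.
rewrite -exprVn leNgt; apply/negP => /kmin.
by rewrite ltnn.
Qed.

Lemma half_le_ln2 (R : realType) : 2^-1 <= ln (2 : R).
Proof.
rewrite -ler_expR lnK ?posrE //.
apply: le_trans (expR_le_quad _) _; first by rewrite ger0_norm.
by lra.
Qed.

Lemma sexpect_sum (R : realType) nS nA n (P : mkernel R nS nA) (I : finType)
    (G : I -> msample nS nA n -> R) :
  sexpect P (fun w => \sum_i G i w) = \sum_i sexpect P (G i).
Proof.
rewrite /sexpect exchange_big /=; apply: eq_bigr => w _; exact: mulr_sumr.
Qed.

Lemma sexpectD (R : realType) nS nA n (P : mkernel R nS nA)
    (G H : msample nS nA n -> R) :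
  sexpect P (fun w => G w + H w) = sexpect P G + sexpect P H.
Proof. by rewrite -big_split; apply: eq_bigr => w _; rewrite mulrDr. Qed.

Lemma sexpectZ (R : realType) nS nA n (P : mkernel R nS nA)
    (G : msample nS nA n -> R) c :
  sexpect P (fun w => c * G w) = c * sexpect P G.
Proof. by rewrite mulr_sumr; apply: eq_bigr => w _; rewrite mulrCA. Qed.

Lemma sexpect_const (R : realType) nS nA n (P : mkernel R nS nA) c :
  is_kernel P -> sexpect P (fun _ : msample nS nA n => c) = c.
Proof. by move=> Pk; rewrite /sexpect -mulr_suml sum_sample_prob // mul1r. Qed.

Lemma ler_sum_term (R : realType) (I : finType) (F : I -> R) i :
  (forall j, 0 <= F j) -> F i <= \sum_j F j.
Proof. by move=> F0; rewrite (bigD1 i) //= lerDl sumr_ge0. Qed.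

(** Markov's inequality for the weighted sum: outside [E] some term [c i * G i w] reaches 1, hence
    so does the sum. *)
Lemma Prob_union (R : realType) nS nA n (P : mkernel R nS nA) (I : finType)
    (G : I -> msample nS nA n -> R) (c M : I -> R) (E : msample nS nA n -> Prop) delta :
  is_kernel P -> (forall i w, 0 <= G i w) -> (forall i, 0 <= c i) ->
  (forall i, sexpect P (G i) <= M i) -> \sum_i c i * M i <= delta ->
  (forall w, (forall i, c i * G i w < 1) -> E w) -> 1 - delta <= Prob P E.
Proof.
move=> Pk G0 c0 GM cM EG.
apply: (@Prob_ge _ _ _ _ _ _ (fun w => \sum_i c i * G i w)) => //.
- by move=> w; apply: sumr_ge0 => i _; rewrite mulr_ge0.
- move=> w nE; rewrite leNgt; apply/negP => lt; apply: nE; apply: EG => i.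
  apply: le_lt_trans lt; apply: (@ler_sum_term _ _ (fun i => c i * G i w)) => j.
  by rewrite mulr_ge0.
rewrite sexpect_sum; apply: le_trans cM; apply: ler_sum => i _.
by rewrite sexpectZ ler_wpM2l.
Qed.

(** The rate is random through [F w], which is admissible when [F] ignores the samples at [(s, a)];
    adding 1 to the span keeps the tuning parameter positive. *)
Definition var_test (R : realType) nS nA n (P : mkernel R nS nA) s a
    (F : msample nS nA n -> 'cV[R]_nS) ell :=
  exp_sample_sum s a (fun w x =>
    tuned_rate ell n (spnorm (F w) + 1) * (F w x 0 - expect (P s a) ((F w)^~ 0))
    - 2 * tuned_rate ell n (spnorm (F w) + 1) ^+ 2
      * expect (P s a) (fun x => (F w x 0 - expect (P s a) ((F w)^~ 0)) ^+ 2)).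

Lemma spnorm_ge0 (R : realType) n (x : 'cV[R]_n) (s : 'I_n) : 0 <= spnorm x.
Proof. by have := spnorm_ge x s s; rewrite subrr. Qed.

Lemma sexpect_var_test (R : realType) nS nA n (P : mkernel R nS nA) s a
    (F : msample nS nA n -> 'cV[R]_nS) ell :
  is_kernel P -> (0 < n)%N -> 0 < ell ->
  (forall w i x, F (sample_set w (s, a, i) x) = F w) ->
  sexpect P (var_test P s a F ell) <= 1.
Proof.
move=> Pk n0 ell0 Fset; have [P0 P1] := Pk.
apply: sexpect_chernoff => // [w i x|w]; first by rewrite Fset.
have b0 : 0 < spnorm (F w) + 1 by rewrite ltr_wpDl // (spnorm_ge0 _ s).
have l0 := tuned_rate_gt0 ell0 n0 b0.
apply: (@expect_expR_var _ _ (P s a) ((F w)^~ 0)) => //; first exact: ltW.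
move=> x y; apply: le_trans (tuned_rate_le ell n b0).
by rewrite ler_wpM2l ?(ltW l0) // (le_trans (spnorm_ge _ x y)) // lerDl.
Qed.

Definition selfnorm_test (R : realType) nS nA n (P : mkernel R nS nA) s a
    (h : 'cV[R]_nS) ell : msample nS nA n -> R :=
  exp_sample_sum s a (fun=> fun x =>
    tuned_rate ell n (spnorm h + 7) * (expect (P s a) (h^~ 0) - h x 0)
    - 2 * (tuned_rate ell n (spnorm h + 7) * (expect (P s a) (h^~ 0) - h x 0)) ^+ 2).

Lemma sexpect_selfnorm_test (R : realType) nS nA n (P : mkernel R nS nA) s a
    (h : 'cV[R]_nS) ell :
  is_kernel P -> (0 < n)%N -> 0 < ell ->
  sexpect P (@selfnorm_test R nS nA n P s a h ell) <= 1.
Proof.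
move=> Pk n0 ell0; have [P0 P1] := Pk.
apply: sexpect_chernoff => // w.
have b0 : 0 < spnorm h + 7 by rewrite ltr_wpDl // (spnorm_ge0 _ s).
have l0 := tuned_rate_gt0 ell0 n0 b0.
apply: (@expect_expR_selfnorm _ _ (P s a) (h^~ 0)) => //; first exact: ltW.
move=> x y; apply: le_trans (tuned_rate_le ell n b0).
by rewrite ler_wpM2l ?(ltW l0) // (le_trans (spnorm_ge _ x y)) // lerDl.
Qed.

Lemma ex_expr_div_le (R : realType) (g e : R) : 0 <= g < 1 -> 0 < e ->
  exists N, g ^+ N / (1 - g) <= e.
Proof.
move=> /andP[g0 g1] e0; have i0 : 0 < 1 - g by rewrite subr_gt0.
have g1' : `|g| < 1 by rewrite ger0_norm.
have /cvgrPdist_le/(_ (e * (1 - g)) (mulr_gt0 e0 i0))[N _ hN] := cvg_expr g1'.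
exists N; rewrite ler_pdivrMr //.
by apply: le_trans (hN N (leqnn N)); rewrite /= sub0r normrN ler_norm.
Qed.

Lemma policy_unique (R : realType) nS nA (pi1 pi2 : policy R nS nA) :
  nA = 1%N -> is_policy pi1 -> is_policy pi2 -> pi1 = pi2.
Proof.
move=> e [_ p1] [_ p2]; subst nA; apply/funext => s; apply/funext => a.
by have := p1 s; have := p2 s; rewrite !big_ord1 (ord1 a) => -> ->.
Qed.

(* Level k carries at most D 2^(k+2) tests, so the factor 3 leaves a total failure
   probability of at most delta 2^-(k+1) there. *)
Definition conf_level (R : realType) (D delta : R) k : R :=
  3 * ln (D * 2 ^+ k.+1 / delta).

Lemma conf_arg_ge2 (R : realType) (D delta : R) k :
  1 <= D -> 0 < delta < 1 -> 2 <= D * 2 ^+ k.+1 / delta.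
Proof.
move=> D1 /andP[d0 d1]; rewrite ler_pdivlMr //.
have p1 : 1 <= 2 ^+ k :> R by apply: exprn_ege1; rewrite ler1n.
have : 2 * delta <= 2 by lra.
move/le_trans; apply; rewrite exprS.
have : 1 * 1 <= D * 2 ^+ k by apply: ler_pM.
lra.
Qed.

Lemma conf_level_ge1 (R : realType) (D delta : R) k :
  1 <= D -> 0 < delta < 1 -> 1 <= conf_level D delta k.
Proof.
move=> D1 d01; have h := conf_arg_ge2 k D1 d01.
have : ln 2 <= ln (D * 2 ^+ k.+1 / delta) by rewrite ler_ln ?posrE //; lra.
by have := half_le_ln2 R; rewrite /conf_level; lra.
Qed.

Lemma conf_level_sum (R : realType) (D delta : R) K : 1 <= D -> 0 < delta < 1 ->
  \sum_(k < K) expR (- conf_level D delta k) * (D * 2 ^+ k.+2) <= delta.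
Proof.
move=> D1 d01; have /andP[d0 d1] := d01.
have step k : expR (- conf_level D delta k) * (D * 2 ^+ k.+2) <= delta * 2^-1 ^+ k.+1.
  have h := conf_arg_ge2 k D1 d01; set x := D * _ / _ in h.
  have x0 : 0 < x by lra.
  have D0 : 0 < D by lra.
  have -> : expR (- conf_level D delta k) = x ^- 3.
    by rewrite expRN /conf_level expRM_natl lnK ?posrE.
  have p0 : 0 < 2 ^+ k.+1 :> R by rewrite exprn_gt0.
  have -> : D * 2 ^+ k.+2 = 2 * delta * x by rewrite /x exprS; field; rewrite gt_eqF.
  have -> : x ^- 3 * (2 * delta * x) = delta * (2 / x ^+ 2) by field; rewrite gt_eqF.
  rewrite ler_wpM2l ?(ltW d0) // exprVn ler_pdivrMr ?exprn_gt0 // ler_pdivlMl //.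
  have px : 2 ^+ k.+1 <= x.
    rewrite /x ler_pdivlMr // mulrC; apply: ler_pM => //; lra.
  rewrite expr2 mulrC; apply: ler_pM => //; lra.
have sumE : \sum_(k < K) delta * 2^-1 ^+ k.+1 = delta * (1 - 2^-1 ^+ K).
  elim: K => [|K IH]; first by rewrite big_ord0 expr0; ring.
  by rewrite big_ord_recr /= IH exprS; field.
apply: (@le_trans _ _ (\sum_(k < K) delta * 2^-1 ^+ k.+1)).
  by apply: ler_sum => k _; exact: step.
rewrite sumE.
by rewrite ler_piMr ?(ltW d0) // gerBl exprn_ge0 // invr_ge0.
Qed.

Lemma conf_level_le (R : realType) (D delta x : R) k :
  2 <= D -> 0 < delta < 1 -> 0 < x <= 1 -> 2 ^+ k.+1 <= 2 / x ->
  conf_level D delta k <= 24 * ln (D / (delta * x)) ^+ 3.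
Proof.
move=> D2 /andP[d0 d1] /andP[x0 x1] kx.
have dx0 : 0 < delta * x by rewrite mulr_gt0.
have y2 : 2 <= D / (delta * x).
  rewrite ler_pdivlMr //; have : delta * x <= 1 * 1 by apply: ler_pM => //; lra.
  lra.
set y := D / _ in y2 *.
have L1 : ln 2 <= ln y by rewrite ler_ln ?posrE //; lra.
have : conf_level D delta k <= 3 * (ln 2 + ln y).
  rewrite /conf_level ler_pM2l // -lnM ?posrE //; last lra.
  rewrite ler_ln ?posrE //; last 2 first.
  - by rewrite divr_gt0 // mulr_gt0 ?exprn_gt0 //; lra.
  - by rewrite mulr_gt0 //; lra.
  have -> : 2 * y = D * (2 / x) / delta by rewrite /y; field; rewrite !gt_eqF.
  rewrite ler_pM2r ?invr_gt0 // ler_wpM2l //; lra.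
have := half_le_ln2 R; move: (ln 2) (ln y) L1 => l L lL l2 h.
(* [L >= ln 2 >= 1/2] gives [L <= 4 L^3]; with [conf_level <= 6 L] this is the constant 24. *)
have : 4^-1 * L <= L ^+ 2 * L.
  by rewrite ler_wpM2r; [nra|lra|have := @sqr_ge0 _ (L - 2^-1); nra].
rewrite -exprSr; lra.
Qed.

(** Below the threshold the bounds add up to 20 + 150 = 170. Above it [q] exceeds 1/64, so [170 * q]
    exceeds 1, which bounds the total anyway. *)
Lemma gap_combine (R : realType) (gap1 gap2 e1 e2 X : R) :
  gap1 + gap2 <= 1 -> (e1 <= 64^-1 -> gap1 <= 20 * e1) ->
  (e2 <= 64^-1 -> gap2 <= 150 * e2) -> 0 <= e1 -> 0 <= e2 ->
  e1 ^+ 2 <= 168 * X -> e2 ^+ 2 <= 168 * X ->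
  gap1 + gap2 <= Num.sqrt (170 ^+ 2 * 168 * X).
Proof.
move=> le1 g1 g2 e10 e20 e1X e2X.
have X0 : 0 <= 168 * X by apply: le_trans e1X; exact: sqr_ge0.
rewrite -mulrA sqrtrM ?exprn_ge0 // sqrtr_sqr ger0_norm //.
set q := Num.sqrt _; have q0 : 0 <= q by exact: sqrtr_ge0.
have q2 : q ^+ 2 = 168 * X by exact: sqr_sqrtr.
have e1q : e1 <= q by rewrite -ler_sqr ?nnegrE // q2.
have e2q : e2 <= q by rewrite -ler_sqr ?nnegrE // q2.
have [/g1 h1|h1] := leP e1 64^-1; last by lra.
have [/g2 h2|h2] := leP e2 64^-1; last by lra.
lra.
Qed.

Definition pinned_col (R : realType) nS nA n r (g : R) N s a j
    (w : msample nS nA n) : 'cV[R]_nS :=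
  \col_x pinned_value (Phat R w) r g (s, a) (j%:R / n%:R) N x.

Lemma sqr_rate_le (R : realType) (ell L N x y : R) :
  0 < ell -> ell <= 24 * L -> 0 < N -> 0 <= x -> x <= y ->
  Num.sqrt (ell * (x + 7) / N) ^+ 2 <= 168 * (L / N * (y + 1)).
Proof.
move=> ell0 ellL N0 x0 xy; have e0 := ltW ell0; rewrite sqr_sqrtr; last first.
  by apply: divr_ge0 (ltW N0); apply: mulr_ge0 e0 _; exact: addr_ge0.
(* 168 = 24 * 7: 24 from the logarithm, 7 from [x + 7 <= 7 (y + 1)]. *)
have -> : 168 * (L / N * (y + 1)) = (24 * L) * (7 * (y + 1)) / N by ring.
by rewrite ler_pM2r ?invr_gt0 //; apply: ler_pM => //; lra.
Qed.

Lemma gap_of_tests (R : realType) nS nA n (P : mkernel R nS nA) r d dh pih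
    delta k N (w : msample nS nA n) s0 :
  is_kernel P -> (forall s a, 0 <= r s a <= 1) -> (0 < n)%N -> 0 < delta < 1 ->
  (1 < nS * nA * n)%N -> weakly_communicating P -> blackwell_optimal P r d ->
  weakly_communicating (Phat R w) -> blackwell_optimal (Phat R w) r dh ->
  is_policy pih -> bias_optimal (Phat R w) r dh pih ->
  let h := bias P r (of_det d) in
  let hh := bias (Phat R w) r (of_det dh) in
  let ghat := gamma_hat_star (Phat R w) r hh n in
  let ell := conf_level (nS * nA * n)%:R delta k in
  let g := 1 - 2^-1 ^+ k.+1 in
  2^-1 ^+ k.+1 < 1 - ghat -> 2 ^+ k.+1 <= 2 / (1 - ghat) ->
  g ^+ N / (1 - g) <= n%:R^-1 ->
  (forall s a, selfnorm_test P s a h ell w <= expR ell) ->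
  (forall s a j, (j <= n * 2 ^ k.+1)%N ->
     var_test P s a (pinned_col r g N s a j) ell w <= expR ell) ->
  gain P r (of_det d) s0 0 - gain P r pih s0 0 <=
  Num.sqrt (170 ^+ 2 * 168 * (ln ((nS * nA * n)%:R / (delta * (1 - ghat)))) ^+ 3 / n%:R
                  * (spnorm h + spnorm hh + 1)).
Proof.
move=> Pk r01 n0 d01 D1 wcP boP wcw bow pk bopt h hh ghat ell g kghat kghat' gN st vt.
have Phk := is_kernel_Phat R w n0.
have [/andP[gh0 gh1] hcl] := gamma_hat_star_spec Phk n0 wcw bow.
rewrite -/hh -/ghat in gh0 gh1 hcl.
have D2 : 2 <= (nS * nA * n)%:R :> R by rewrite ler_nat.
have D1' : 1 <= (nS * nA * n)%:R :> R by lra.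
have ell1 : 1 <= ell := conf_level_ge1 k D1' d01.
have ell0 : 0 < ell by lra.
have i0 : 0 < 2^-1 ^+ k.+1 :> R by rewrite exprn_gt0 // invr_gt0.
have i1 : 2^-1 ^+ k.+1 <= 1 :> R by rewrite exprn_ile1 ?invr_ge0 // invf_le1 // ler1n.
have [gg g1] : ghat < g /\ g < 1 by rewrite /g; split; lra.
have g01 : 0 <= g < 1 by rewrite g1 andbT subr_ge0.
have ellL : ell <= 24 * ln ((nS * nA * n)%:R / (delta * (1 - ghat))) ^+ 3.
  by apply: conf_level_le => //; apply/andP; split; lra.
have h0 : 0 <= spnorm h := spnorm_ge0 h s0.
have hh0 : 0 <= spnorm hh := spnorm_ge0 hh s0.
have h7 : 0 < spnorm h + 7 := ltr_wpDl h0 (ltr0Sn _ _).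
have nR : 0 < n%:R :> R by rewrite ltr0n.
have -> : gain P r (of_det d) s0 0 - gain P r pih s0 0
  = (gain P r (of_det d) s0 0 - gain (Phat R w) r (of_det dh) s0 0)
    + (gain (Phat R w) r (of_det dh) s0 0 - gain P r pih s0 0) by ring.
set L3 := ln _ ^+ 3 in ellL *.
rewrite -(mulrA _ L3) -(mulrA _ (L3 / _)).
have epsX x : 0 <= x -> x <= spnorm h + spnorm hh ->
    Num.sqrt (ell * (x + 7) / n%:R) ^+ 2
      <= 168 * (L3 / n%:R * (spnorm h + spnorm hh + 1)).
  by move=> x0 xle; apply: sqr_rate_le.
apply: (@gap_combine _ _ _ (Num.sqrt (ell * (spnorm h + 7) / n%:R))
  (Num.sqrt (ell * (spnorm hh + 7) / n%:R))); rewrite ?sqrtr_ge0 //.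
- have /andP[_ ?] := gain_bounds s0 Pk r01 (is_policy_of_det R d).
  have /andP[? _] := gain_bounds s0 Pk r01 pk.
  by rewrite addrA subrK lerBlDr -[leLHS]addr0 lerD.
- move=> e1; apply: (@le_trans _ _ (gain P r (of_det d) s0 0
      - gain (Phat R w) r (of_det d) s0 0)).
    by rewrite lerB // blackwell_gain_optimal //; exact: is_policy_of_det.
  apply: star_gap (ell1) _ _ _ _ => // s a.
  apply: (@chernoff_selfnorm_bound _ _ _ _ P s a (h^~ 0)
    (tuned_rate ell n (spnorm h + 7))) => //.
    exact: (tuned_rate_gt0 ell0 n0 h7).
  exact: st.
- move=> e2; apply: (@plugin_gap _ _ _ n P (Phat R w) r g N dh pih ell s0) => //.
    exact: hcl.
  move=> s a j jn.
  apply: (@chernoff_var_bound _ _ _ _ P s a (fun w => (pinned_col r g N s a j w)^~ 0)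
    (fun w => tuned_rate ell n (spnorm (pinned_col r g N s a j w) + 1))) => //.
    by apply: tuned_rate_gt0 => //; rewrite ltr_wpDl // (spnorm_ge0 _ s).
  (* Here [1 - g = 2^-(k+1)], so the grid range becomes [j <= n 2^(k+1)]. *)
  apply: vt; move: jn; rewrite /g opprB addrC subrK exprVn ler_pdivrMr ?exprn_gt0 //.
  by rewrite -natrX -natrM ler_nat.
- by apply: (epsX _ h0); rewrite lerDl.
- by apply: (epsX _ hh0); rewrite lerDr.
Qed.

Lemma pinned_col_off (R : realType) nS nA n r (g : R) N s a j
    (w : msample nS nA n) i x :
  pinned_col r g N s a j (sample_set w (s, a, i) x) = pinned_col r g N s a j w.
Proof. by apply/colP => y; rewrite !mxE pinned_value_off. Qed.

Definition level_sum (R : realType) nS nA n (P : mkernel R nS nA) r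
    (h : 'cV[R]_nS) (N : nat -> nat) ell k (w : msample nS nA n) : R :=
  \sum_(q : 'I_nS * 'I_nA) (selfnorm_test P q.1 q.2 h ell w
    + \sum_(j < (n * 2 ^ k.+1).+1)
        var_test P q.1 q.2 (pinned_col r (1 - 2^-1 ^+ k.+1) (N k) q.1 q.2 j) ell w).

Lemma sexpect_level_sum (R : realType) nS nA n (P : mkernel R nS nA) r h N ell k :
  is_kernel P -> (0 < n)%N -> 0 < ell ->
  sexpect P (@level_sum R nS nA n P r h N ell k) <= (nS * nA * n)%:R * 2 ^+ k.+2.
Proof.
move=> Pk n0 ell0; rewrite /level_sum sexpect_sum.
apply: (@le_trans _ _ (\sum_(q : 'I_nS * 'I_nA) (n * 2 ^ k.+2)%:R)).
  apply: ler_sum => q _; rewrite sexpectD sexpect_sum.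
  apply: (@le_trans _ _ (1 + \sum_(j < (n * 2 ^ k.+1).+1) 1)).
    apply: lerD; first exact: sexpect_selfnorm_test.
    apply: ler_sum => j _; apply: sexpect_var_test => // w i x.
    exact: pinned_col_off.
  (* One self-normalised test and [n 2^(k+1) + 1] grid tests per pair: in total at most [n 2^(k+2)],
     as [n 2^(k+1) >= 2]. *)
  rewrite sumr_const card_ord nat1r ler_nat.
  rewrite [(2 ^ k.+2)%N]expnS mulnCA mul2n -addnn -addn2 leq_add2l.
  by rewrite (@leq_trans (1 * 2 ^ 1)) // leq_mul // leq_pexp2l.
rewrite sumr_const card_prod !card_ord -mulrnA -natrX -natrM ler_nat.
by rewrite mulnC mulnA.
Qed.

Lemma level_sum_tests (R : realType) nS nA n (P : mkernel R nS nA) r h N ell k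
    (w : msample nS nA n) e : level_sum P r h N ell k w <= e ->
  (forall s a, selfnorm_test P s a h ell w <= e) /\
  (forall s a j, (j <= n * 2 ^ k.+1)%N ->
     var_test P s a (pinned_col r (1 - 2^-1 ^+ k.+1) (N k) s a j) ell w <= e).
Proof.
set T := fun q : 'I_nS * 'I_nA => selfnorm_test P q.1 q.2 h ell w
    + \sum_(j < (n * 2 ^ k.+1).+1)
        var_test P q.1 q.2 (pinned_col r (1 - 2^-1 ^+ k.+1) (N k) q.1 q.2 j) ell w.
have V0 s a F : 0 <= var_test P s a F ell w by exact: expR_ge0.
have S0 s a : 0 <= selfnorm_test P s a h ell w by exact: expR_ge0.
have T0 q : 0 <= T q by rewrite addr_ge0 // sumr_ge0.
move=> le; split=> s a; last move=> j jn.
  apply: le_trans le; apply: le_trans (ler_sum_term (s, a) T0).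
  by rewrite /T lerDl sumr_ge0.
apply: le_trans le; apply: le_trans (ler_sum_term (s, a) T0).
apply: (@le_trans _ _ (\sum_(j < (n * 2 ^ k.+1).+1)
  var_test P s a (pinned_col r (1 - 2^-1 ^+ k.+1) (N k) s a j) ell w)).
  rewrite -ltnS in jn.
  exact: (@ler_sum_term _ _ (fun j : 'I__ => var_test P s a
    (pinned_col r (1 - 2^-1 ^+ k.+1) (N k) s a j) ell w) (Ordinal jn)).
by rewrite /T lerDr.
Qed.

Theorem mainTheorem1 (R : realType) :
  exists C : R, 0 < C /\
  forall (nS nA n : nat) (P : mkernel R nS nA) (r : 'I_nS -> 'I_nA -> R)
         (pistar : det_policy nS nA)
         (dhat : msample nS nA n -> det_policy nS nA)
         (pihat : msample nS nA n -> policy R nS nA) (delta : R),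
    is_kernel P ->
    (forall s a, 0 <= r s a <= 1) ->
    (0 < n)%N ->
    0 < delta < 1 ->
    weakly_communicating P ->
    blackwell_optimal P r pistar ->
    (forall w, blackwell_optimal (Phat R w) r (dhat w)) ->
    (forall w, is_policy (pihat w) /\ bias_optimal (Phat R w) r (dhat w) (pihat w)) ->
    1 - delta <= Prob P (fun w =>
      weakly_communicating (Phat R w) ->
      let hstar := bias P r (of_det pistar) in
      let hhat := bias (Phat R w) r (of_det (dhat w)) in
      let ghat := gamma_hat_star (Phat R w) r hhat n in
      forall s : 'I_nS,
        gain P r (of_det pistar) s 0 - gain P r (pihat w) s 0 <=
        Num.sqrt (C * (ln ((nS * nA * n)%:R / (delta * (1 - ghat)))) ^+ 3 / n%:R
                  * (spnorm hstar + spnorm hhat + 1))).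
Proof.
exists (170 ^+ 2 * 168); split; first by rewrite mulr_gt0 // exprn_gt0.
move=> nS nA n P r d dhat pihat delta Pk r01 n0 d01 wcP boP bow pihatP.
have triv E : (forall w, E w) -> 1 - delta <= @Prob R nS nA P n E.
  move=> Ew; apply: (@Prob_ge _ _ _ _ _ _ (fun=> 0)) => //.
  by rewrite sexpect_const //; have /andP[/ltW] := d01.
have [nS0|nS0] := posnP nS.
  by apply: triv => w _ h hh ghat s; have := ltn_ord s; rewrite [X in (_ < X)%N]nS0.
have nA0 : (0 < nA)%N by apply: leq_ltn_trans (ltn_ord (d (Ordinal nS0))).
have D0 : (0 < nS * nA * n)%N by rewrite !muln_gt0 nS0 nA0.
have D1 : 1 <= (nS * nA * n)%:R :> R by rewrite ler1n.
(* When the product is 1 the logarithm can be arbitrarily close to 0, but a single action leaves a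
   single policy and the gap is 0. *)
have [Dle|D2] := leqP (nS * nA * n) 1.
  have /eqP : (nS * nA * n)%N = 1%N by apply/eqP; rewrite eqn_leq Dle.
  rewrite !muln_eq1 => /andP[/andP[_ /eqP nA1] _].
  apply: triv => w _ h hh ghat s.
  have [pk _] := pihatP w.
  by rewrite (policy_unique nA1 (is_policy_of_det R d) pk) subrr sqrtr_ge0.
have exN k : exists N, (1 - 2^-1 ^+ k.+1) ^+ N / (1 - (1 - 2^-1 ^+ k.+1)) <= n%:R^-1 :> R.
  have i0 : 0 < 2^-1 ^+ k.+1 :> R by rewrite exprn_gt0 // invr_gt0.
  have i1 : 2^-1 ^+ k.+1 <= 1 :> R by rewrite exprn_ile1 ?invr_ge0 // invf_le1 // ler1n.
  apply: ex_expr_div_le; last by rewrite invr_gt0 ltr0n.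
  by rewrite subr_ge0 i1 /= ltrBlDr ltrDl.
(* The iteration count depends on the level alone, so the tests are fixed before sampling. *)
have [N hN] := choice exN.
pose ghat w := gamma_hat_star (Phat R w) r (bias (Phat R w) r (of_det (dhat w))) n.
have exk (w : msample nS nA n) : exists k, weakly_communicating (Phat R w) ->
    2^-1 ^+ k.+1 < 1 - ghat w /\ 2 ^+ k.+1 <= 2 / (1 - ghat w).
  have [wc|nwc] := pselect (weakly_communicating (Phat R w)); last by exists 0%N.
  have [/andP[g0 g1] _] := gamma_hat_star_spec (is_kernel_Phat R w n0) n0 wc (bow w).
  have [|k hk] := @ex_dyadic R (1 - ghat w); last by exists k.
  by rewrite subr_gt0 g1 gerBl.
have [kw hk] := choice exk.
(* The level [kw w] is data-dependent, but there are finitely many samples, so finitely many levels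
   cover all of them; the bound in [conf_level_sum] is uniform in [K]. *)
pose K := (\max_w kw w).+1.
set h := bias P r (of_det d).
pose ell := conf_level (nS * nA * n)%:R delta.
have ell0 k : 0 < ell k by apply: lt_le_trans (conf_level_ge1 k D1 d01).
apply: (@Prob_union R nS nA n P 'I_K (fun k => level_sum P r h N (ell k) k)
  (fun k => expR (- ell k)) (fun k => (nS * nA * n)%:R * 2 ^+ k.+2)) => //.
- move=> k w; apply: sumr_ge0 => q _; rewrite addr_ge0 ?expR_ge0 //.
  by apply: sumr_ge0 => j _; exact: expR_ge0.
- by move=> k; exact: sexpect_level_sum.
- exact: conf_level_sum.
move=> w tests wc /= s.
have [kg kg'] := hk w wc; have [pk bopt] := pihatP w.
have kK : (kw w < K)%N by rewrite ltnS leq_bigmax.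
have := tests (Ordinal kK); rewrite expRN mulrC ltr_pdivrMr ?expR_gt0 // mul1r.
move=> /ltW/level_sum_tests[st vt].
exact: (gap_of_tests s Pk r01 n0 d01 D2 wcP boP wc (bow w) pk bopt kg kg' (hN _) st vt).
Qed.
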